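(* The linear combination of permutations \[\rho^*:= \mathtt{123}+\mathtt{321} + \mathtt{2143}+\mathtt{3412}+ \frac{1}{2}\left(\mathtt{2413} + \mathtt{3142}\right)\] is quasirandom-forcing.
   Context: A permutation of order $n$ is a bijection $\pi:[n]\to[n]$, written as the word $\pi(1)\pi(2)\cdots\pi(n)$; $|\pi|$ denotes its order and $S_n$ the set of permutations of order $n$. For permutations $\sigma\in S_k$ and $\pi\in S_n$, a copy of $\sigma$ in $\pi$ is a set $\{x_1<\dots<x_k\}\subseteq[n]$ with $\pi(x_i)<\pi(x_j)$ iff $\sigma(i)<\sigma(j)$. The density $d(\sigma,\pi)$ is the number of copies of $\sigma$ in $\pi$ divided by $\binom{n}{k}$ if $k\le n$, and $0$ if $k>n$. Density is extended linearly to formal linear combinations: $d(\sum_i c_i\sigma_i,\pi)=\sum_i c_i d(\sigma_i,\pi)$. A sequence $(\pi_n)_{n\ge1}$ of permutations is quasirandom if $\lim_{n\to\infty} d(\sigma,\pi_n)=1/|\sigma|!$ for every permutation $\sigma$. A linear combination $\sum_{i=1}^r c_i\sigma_i$ of permutations is quasirandom-forcing if every sequence $(\pi_n)$ with $|\pi_n|\to\infty$ and $\lim_{n\to\infty} d(\sum_i c_i\sigma_i,\pi_n)=\sum_i c_i/|\sigma_i|!$ is quasirandom. *)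

(* Defs.v *)
From HB Require Import structures.
From mathcomp Require Import all_boot all_order all_algebra all_fingroup.
From mathcomp Require Import all_classical all_reals all_analysis.

Set Implicit Arguments.
Unset Strict Implicit.
Unset Printing Implicit Defensive.

Import Order.TTheory GRing.Theory Num.Theory.
Import numFieldNormedType.Exports.

Local Open Scope classical_set_scope.
Local Open Scope ring_scope.

Definition permutation := {k : nat & 'S_k}.

Definition perm_order (s : permutation) : nat := tag s.

(* 'S_k permutes {0, ..., k - 1}; the letters of the word are shifted by one
   so that it is the usual word on {1, ..., k}. *)
Definition word (k : nat) (s : 'S_k) : seq nat :=
  [seq (val (s i)).+1 | i <- enum 'I_k].

(* The default value 1 is only used when w is not the word of a permutation,
   see of_wordK. *)
Definition of_word (w : seq nat) : permutation :=
  Tagged (fun k => 'S_k)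
    (odflt 1%g [pick s : 'S_(size w) | word s == w]).

Lemma of_wordK (w : seq nat) :
  perm_eq w (iota 1 (size w)) -> word (tagged (of_word w)) = w.
Proof.
move=> pw; rewrite /of_word /=; case: pickP => [s /eqP //|no_s].
have w_in (i : 'I_(size w)) : ((nth 0 w i).-1 < size w)%N.
  have : nth 0%N w i \in iota 1 (size w) by rewrite -(perm_mem pw) mem_nth.
  by rewrite mem_iota; case: nth.
have w_gt0 (i : 'I_(size w)) : (0 < nth 0 w i)%N.
  have : nth 0%N w i \in iota 1 (size w) by rewrite -(perm_mem pw) mem_nth.
  by rewrite mem_iota => /andP[].
pose f (i : 'I_(size w)) : 'I_(size w) := Ordinal (w_in i).
have f_inj : injective f.
  move=> i j /(congr1 (fun x : 'I__ => x.+1)) /=; rewrite !prednK //.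
  move=> /eqP; rewrite nth_uniq ?(perm_uniq pw) ?iota_uniq // => /eqP.
  exact: val_inj.
have /negP[] := negbT (no_s (perm f_inj)); apply/eqP.
apply: (@eq_from_nth _ 0%N); first by rewrite size_map size_enum_ord.
move=> i; rewrite size_map size_enum_ord => i_lt.
rewrite (nth_map (Ordinal i_lt)) ?size_enum_ord //.
by rewrite permE /= nth_enum_ord // (prednK (w_gt0 (Ordinal i_lt))).
Qed.

Definition copy (k n : nat) (s : 'S_k) (p : 'S_n) (A : {set 'I_n}) : bool :=
  [exists x : {ffun 'I_k -> 'I_n},
    [&& [forall i : 'I_k, forall j : 'I_k, (i < j)%N ==> (x i < x j)%N],
        A == [set x i | i : 'I_k]%SET &
        [forall i : 'I_k, forall j : 'I_k, (p (x i) < p (x j))%N == (s i < s j)%N]]].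

Definition density (R : realType) (s p : permutation) : R :=
  if (perm_order s <= perm_order p)%N then
    #|copy (tagged s) (tagged p)|%:R
      / 'C(perm_order p, perm_order s)%:R
  else 0.

(* The list [:: (c_1, s_1); ...; (c_r, s_r)] stands for \sum_i c_i s_i. *)
Definition lincomb (R : realType) := seq (R * permutation).

Definition lincomb_density (R : realType) (c : lincomb R) (p : permutation) : R :=
  \sum_(t <- c) t.1 * density R t.2 p.

Definition quasirandom (R : realType) (p : nat -> permutation) : Prop :=
  forall s : permutation,
    (fun n => density R s (p n)) @ \oo --> ((perm_order s)`!%:R^-1 : R).

Definition quasirandom_forcing (R : realType) (c : lincomb R) : Prop :=
  forall p : nat -> permutation,
    (fun n => perm_order (p n)) @ \oo --> \oo ->
    (fun n => lincomb_density c (p n)) @ \oo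
      --> \sum_(t <- c) t.1 / (perm_order t.2)`!%:R ->
    quasirandom R p.

Definition rho_star (R : realType) : lincomb R :=
  [:: (1, of_word [:: 1; 2; 3]%N);
      (1, of_word [:: 3; 2; 1]%N);
      (1, of_word [:: 2; 1; 4; 3]%N);
      (1, of_word [:: 3; 4; 1; 2]%N);
      (2^-1, of_word [:: 2; 4; 1; 3]%N);
      (2^-1, of_word [:: 3; 1; 4; 2]%N)].

Lemma rho_star_words (R : realType) :
  [seq word (tagged t.2) | t <- rho_star R] =
  [:: [:: 1; 2; 3]; [:: 3; 2; 1]; [:: 2; 1; 4; 3]; [:: 3; 4; 1; 2];
      [:: 2; 4; 1; 3]; [:: 3; 1; 4; 2]]%N.
Proof. by congr [:: _; _; _; _; _; _]; apply: of_wordK. Qed.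

(* Main.v *)
Require Import Defs.
From mathcomp Require Import all_boot all_order all_algebra all_reals.
From mathcomp Require Import all_fingroup all_classical all_analysis.
From mathcomp Require Import ring lra zify.

(** Encode a permutation by the signs [sx z B], [sy z B] of the differences of
    positions and of values of the points [z] and [B].  Centering both kernels
    in both arguments yields [k z B = n * s z B + m z - m B], a sawtooth in
    [B - z], and [A B C = \sum_z kx z B * ky z C] measures how far the
    permutation is from the product measure.  A polynomial [P] in the signs of
    four points, whose sum over all quadruples is
    ['C(n, 4) * (64 * d(rho_star) - 24) + O(n^3)], satisfies the exact identity
      [n^4 * \sum P = 2 n \sum_B (A B B)^2 + 4 \sum_(B, C) (A B C)^2
         + \sum_(B, C) A B C * A C B + squares + n^4 * (2/9 n^4 + O(n^2))].
    The only term of unknown sign is at most [\sum (A B C)^2] in absolute value,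
    so [d(rho_star) >= 11/24 - o(1)], and [d(rho_star) --> 11/24] forces [A] to
    tend to 0 in quadratic mean.  Since [A] is Lipschitz it then tends to 0
    uniformly, that is, every box contains about as many points as expected.
    Finally the points of a [k]-tuple are replaced one at a time by uniform
    points of the square: the admissible positions of one point, the others
    being fixed, form a box, so each replacement changes the number of copies of
    a pattern by [o(n^k)]. *)

Set Implicit Arguments.
Unset Strict Implicit.
Unset Printing Implicit Defensive.

Import Order.TTheory GRing.Theory Num.Theory.
Import numFieldNormedType.Exports.

Local Open Scope ring_scope.

(** * Doubly centered sign kernels *)

Section SignKernels.
Variables (R : realFieldType) (T : finType).
Implicit Types (s : T -> T -> R) (B C z w : T).

(** The signs of a linear order satisfy both equations. The second one encodes transitivity and,
    summed over [l], expresses inner products of rows through column sums. *)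
Definition sign_kernel s := forall i j l,
  s j i = - s i j /\
  s i l * s j l = 1 - s i j * (s l j - s l i) - ((i == j) && (i == l))%:R.

Definition colsum s j : R := \sum_i s i j.

Local Notation N := (#|T|%:R : R).

Lemma double_sum_separable (f g : T -> R) :
  \sum_i \sum_j f i * g j = (\sum_i f i) * (\sum_j g j).
Proof. by rewrite mulr_suml; apply: eq_bigr => i _; rewrite mulr_sumr. Qed.

Lemma sum_const_card (c : R) : \sum_(i : T) c = N * c.
Proof. by rewrite sumr_const mulr_natl. Qed.

(** * Column sums and summation by parts for one kernel *)

Section OneKernel.
Variables (s : T -> T -> R) (sP : sign_kernel s).
Local Notation m := (colsum s).

Lemma sign_kernelC i j : s j i = - s i j.
Proof. by case: (sP i j i). Qed.

Lemma sign_kernel_rowsum z : \sum_j s z j = - m z.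
Proof. by rewrite /colsum -sumrN; apply: eq_bigr => j _; exact: sign_kernelC. Qed.

Lemma sum_colsum : \sum_j m j = 0.
Proof.
suff : \sum_j m j = - \sum_j m j by lra.
rewrite -sumrN /colsum exchange_big; apply: eq_bigr => i _.
exact: sign_kernel_rowsum.
Qed.

Lemma sign_kernel_gram z w :
  \sum_l s z l * s w l = N - s z w * (m w - m z) - (z == w)%:R.
Proof.
transitivity (\sum_l (1 - s z w * (s l w - s l z) - ((z == w) && (z == l))%:R)).
  by apply: eq_bigr => l _; case: (sP z w l).
rewrite !sumrB sum_const_card mulr1 -mulr_sumr sumrB; congr (_ - _).
rewrite (bigD1 z) //= eqxx andbT big1 ?addr0 // => l /negbTE lz.
by rewrite [z == l]eq_sym lz andbF.
Qed.

(** Summing [sign_kernel_gram] over [w] reproduces the unknown sum on the right with the opposite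
    sign, so it can be solved for. *)
Lemma sign_kernel_colsum z : 2 * \sum_l s z l * m l = N ^+ 2 - 1 - m z ^+ 2.
Proof.
have E : \sum_l s z l * m l = \sum_w \sum_l s z l * s w l.
  by rewrite exchange_big; apply: eq_bigr => l _; rewrite mulr_sumr.
have : \sum_w \sum_l s z l * s w l
    = N ^+ 2 - \sum_l s z l * m l - m z ^+ 2 - 1.
  under eq_bigr do rewrite sign_kernel_gram mulrBr.
  rewrite !sumrB sum_const_card -mulr_suml sign_kernel_rowsum.
  rewrite [X in _ - X = _](_ : _ = 1); first by ring.
  rewrite (bigD1 z) //= eqxx big1 ?addr0 // => l /negbTE lz.
  by rewrite eq_sym lz.
by rewrite -E; lra.
Qed.

Lemma sum_colsum_sqr : 3 * \sum_j m j ^+ 2 = N * (N ^+ 2 - 1).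
Proof.
have : \sum_z (2 * \sum_l s z l * m l) = 2 * \sum_l m l ^+ 2.
  rewrite -mulr_sumr exchange_big; congr (_ * _).
  by apply: eq_bigr => l _; rewrite -mulr_suml.
under eq_bigr do rewrite sign_kernel_colsum.
by rewrite sumrB sum_const_card; lra.
Qed.

(* Summation by parts: f |-> \sum_z s _ z * f z plays the role of integration. *)
Lemma sign_kernel_parts (f : T -> R) :
  2 * \sum_i (\sum_z s i z * f z) * m i * f i
  = \sum_i (\sum_z s i z * f z) ^+ 2 + \sum_i f i ^+ 2 - N * (\sum_i f i) ^+ 2.
Proof.
(* By antisymmetry, exchanging [i] and [z] trades the factor [m i] for [- m z]. The combination [D]
   of both forms is the one that the Gram identity produces when the squares are expanded. *)
pose D := \sum_i \sum_z s i z * (m z - m i) * f i * f z.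
have E1 : 2 * \sum_i (\sum_z s i z * f z) * m i * f i = - D.
  have E2 : \sum_i (\sum_z s i z * f z) * m i * f i
      = \sum_i \sum_z s i z * m i * f i * f z.
    apply: eq_bigr => i _; rewrite !mulr_suml; apply: eq_bigr => z _; ring.
  have E3 : \sum_i (\sum_z s i z * f z) * m i * f i
      = - \sum_i \sum_z s i z * m z * f i * f z.
    rewrite E2 exchange_big -sumrN; apply: eq_bigr => i _.
    by rewrite -sumrN; apply: eq_bigr => z _; rewrite (sign_kernelC i z); ring.
  have -> : D = \sum_i \sum_z s i z * m z * f i * f z
              - \sum_i \sum_z s i z * m i * f i * f z.
    rewrite /D -sumrB; apply: eq_bigr => i _.
    by rewrite -sumrB; apply: eq_bigr => z _; ring.
  by rewrite -E2; lra.
have E4 : \sum_i (\sum_z s i z * f z) ^+ 2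
    = \sum_z \sum_w f z * f w * \sum_i s z i * s w i.
  transitivity (\sum_i \sum_z \sum_w f z * f w * (s z i * s w i)).
    apply: eq_bigr => i _; rewrite expr2 -double_sum_separable.
    apply: eq_bigr => z _; apply: eq_bigr => w _.
    by rewrite (sign_kernelC i z) (sign_kernelC i w); ring.
  rewrite exchange_big; apply: eq_bigr => z _.
  by rewrite exchange_big; apply: eq_bigr => w _; rewrite mulr_sumr.
rewrite E1 E4.
have -> : \sum_z \sum_w f z * f w * (\sum_i s z i * s w i)
  = \sum_z (\sum_w (N * f z) * f w - \sum_w s z w * (m w - m z) * f z * f w
     - f z ^+ 2).
  apply: eq_bigr => z _.
  rewrite -sumrB [f z ^+ 2](_ : _ = \sum_w f z * f w * (z == w)%:R).
    by rewrite -sumrB; apply: eq_bigr => w _; rewrite sign_kernel_gram; ring.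
  rewrite (bigD1 z) //= eqxx big1 ?addr0 ?mulr1 // => w /negbTE wz.
  by rewrite eq_sym wz mulr0.
by rewrite !sumrB double_sum_separable -mulr_sumr -/D; ring.
Qed.

End OneKernel.

(** * The exact identity for a pair of kernels *)

Section TwoKernels.
Variables (sx sy : T -> T -> R) (sxP : sign_kernel sx) (syP : sign_kernel sy).

Definition concordance B C : R := \sum_z sx z B * sy z C.
Local Notation G := concordance.
Local Notation m := (colsum sx).
Local Notation m' := (colsum sy).
Let a B : R := \sum_C G B C.
Let b C : R := \sum_B G B C.
Let rho : R := \sum_z m z * m' z.
Let kappa : R := \sum_B G B B.

Definition centered_concordance B C : R :=
  \sum_z (N * sx z B + m z - m B) * (N * sy z C + m' z - m' C).
Local Notation A := centered_concordance.

(* Summed over the 24 relabelings of a quadruple, this is 64 g - 24, where g is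
   the average contribution of its pattern to the density of rho*; see
   sym_kernel_patterns. *)
Definition rho_kernel B C z w : R :=
  2 * (sx z B * sy z B) * (sx w B * sy w B)
  + 2 * (sx z B * sy z B) * (sx w C * sy w C)
  + 4 * (sx z B * sy z C) * (sx w B * sy w C)
  + (sx z B * sy z C) * (sx w C * sy w B)
  - 4 * (sx z B * sy z B) * (sx w B * sy w C + sx w C * sy w B)
  - 4 * (sx z B * sy z B) * (sx w B * sy C B).

Let aE B : a B = \sum_z sx B z * m' z.
Proof.
rewrite /a exchange_big; apply: eq_bigr => z _.
by rewrite -mulr_sumr (sign_kernel_rowsum syP) (sign_kernelC sxP z B); ring.
Qed.

Let bE C : b C = \sum_z sy C z * m z.
Proof.
rewrite /b exchange_big; apply: eq_bigr => z _.
by rewrite -mulr_suml (sign_kernel_rowsum sxP) (sign_kernelC syP z C); ring.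
Qed.

Let sum_a : \sum_B a B = rho.
Proof.
under eq_bigr do rewrite aE.
by rewrite exchange_big; apply: eq_bigr => z _; rewrite -mulr_suml.
Qed.

Let sum_b : \sum_C b C = rho.
Proof. by rewrite -sum_a exchange_big. Qed.

Let AE B C : A B C =
  N ^+ 2 * G B C - N * a B - N * b C - N * m B * m' C + rho.
Proof.
rewrite /A.
transitivity (\sum_z (N ^+ 2 * (sx z B * sy z C) + N * (- sx B z * m' z)
   - N * m' C * sx z B + N * (- sy C z * m z) - N * m B * sy z C
   + m z * m' z - m' C * m z - m B * m' z + m B * m' C)).
  apply: eq_bigr => z _.
  by rewrite (sign_kernelC sxP z B) (sign_kernelC syP z C); ring.
rewrite !(sumrB, big_split) /= -!mulr_sumr (sum_colsum sxP) (sum_colsum syP).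
rewrite sum_const_card aE bE -/(G B C) -/rho -/(m B) -/(m' C).
under [\sum_i (- sx B i * _)]eq_bigr do rewrite mulNr.
under [\sum_i (- sy C i * _)]eq_bigr do rewrite mulNr.
by rewrite !sumrN; ring.
Qed.

Let sum_A_row B : \sum_C A B C = 0.
Proof.
under eq_bigr do rewrite AE.
rewrite !(sumrB, big_split) /= -!mulr_sumr !sum_const_card (sum_colsum syP).
by rewrite sum_b -/(a B); ring.
Qed.

Let sum_A_col C : \sum_B A B C = 0.
Proof.
under eq_bigr do rewrite AE.
rewrite !(sumrB, big_split) /= -!mulr_sumr !sum_const_card -mulr_suml.
by rewrite -mulr_sumr (sum_colsum sxP) sum_a -/(b C); ring.
Qed.

(** Summation by parts with [f = m'], whose [sx]-integral is [a]; the last term vanishes because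
    [m'] sums to 0. It trades mixed terms of [sum_A_diag] for the squares that occur in [sum_AA]. *)
Let a_parts : 2 * \sum_B a B * (m B * m' B) = \sum_B a B ^+ 2 + \sum_B m' B ^+ 2.
Proof.
have := sign_kernel_parts sxP m'.
rewrite (sum_colsum syP) expr0n mulr0 subr0 => E.
transitivity (2 * \sum_i (\sum_z sx i z * m' z) * m i * m' i).
  by congr (_ * _); apply: eq_bigr => B _; rewrite aE mulrA.
by rewrite E; congr (_ + _); apply: eq_bigr => B _; rewrite aE.
Qed.

Let b_parts : 2 * \sum_B b B * (m B * m' B) = \sum_B b B ^+ 2 + \sum_B m B ^+ 2.
Proof.
have := sign_kernel_parts syP m.
rewrite (sum_colsum sxP) expr0n mulr0 subr0 => E.
transitivity (2 * \sum_i (\sum_z sy i z * m z) * m' i * m i).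
  by congr (_ * _); apply: eq_bigr => B _; rewrite bE; ring.
by rewrite E; congr (_ + _); apply: eq_bigr => B _; rewrite bE.
Qed.

Let double_exchange (f g u : T -> T -> R) :
  \sum_B \sum_C (\sum_z f z B * g z C) * u B C =
  \sum_z \sum_B \sum_C f z B * g z C * u B C.
Proof.
transitivity (\sum_B \sum_C \sum_z f z B * g z C * u B C).
  by apply: eq_bigr => B _; apply: eq_bigr => C _; rewrite mulr_suml.
transitivity (\sum_B \sum_z \sum_C f z B * g z C * u B C).
  by apply: eq_bigr => B _; rewrite exchange_big.
by rewrite exchange_big.
Qed.

(** At fixed [z] the double sum factors, and [sign_kernel_colsum] evaluates each factor. *)
Let G_mm' : 4 * \sum_B \sum_C G B C * (m B * m' C) =
  \sum_z (N ^+ 2 - 1 - m z ^+ 2) * (N ^+ 2 - 1 - m' z ^+ 2).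
Proof.
rewrite (double_exchange sx sy (fun B C => m B * m' C)) mulr_sumr.
apply: eq_bigr => z _.
rewrite -(sign_kernel_colsum sxP) -(sign_kernel_colsum syP).
transitivity (4 * ((\sum_l sx z l * m l) * (\sum_l sy z l * m' l))); last by ring.
congr (_ * _); rewrite -double_sum_separable.
by apply: eq_bigr => B _; apply: eq_bigr => C _; ring.
Qed.

Let G_mm'_swap : \sum_B \sum_C G B C * (m C * m' B) = \sum_z a z * b z.
Proof.
rewrite (double_exchange sx sy (fun B C => m C * m' B)).
apply: eq_bigr => z _; rewrite aE bE -double_sum_separable.
by apply: eq_bigr => B _; apply: eq_bigr => C _; ring.
Qed.

(** Rows and columns of [A] sum to 0, so terms depending on one argument alone drop out when paired
    with [A]. In a product of two copies of [A], one copy thus reduces to its two bivariate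
    terms. *)
Let sum_A_centered (u v : T -> T -> R) (f g : T -> R) :
  \sum_B \sum_C A B C * (N ^+ 2 * u B C - N * v B C - f B - g C)
  = N ^+ 2 * (\sum_B \sum_C u B C * A B C) - N * (\sum_B \sum_C v B C * A B C).
Proof.
have Ef : \sum_B \sum_C A B C * f B = 0.
  by apply: big1 => B _; rewrite -mulr_suml sum_A_row mul0r.
have Eg : \sum_B \sum_C A B C * g C = 0.
  rewrite exchange_big; apply: big1 => C _.
  by rewrite -mulr_suml sum_A_col mul0r.
transitivity (N ^+ 2 * (\sum_B \sum_C u B C * A B C)
  - N * (\sum_B \sum_C v B C * A B C) - \sum_B \sum_C A B C * f B
  - \sum_B \sum_C A B C * g C); last by rewrite Ef Eg !subr0.
rewrite !mulr_sumr -!(sumrB, big_split) /=; apply: eq_bigr => B _.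
rewrite !mulr_sumr -!(sumrB, big_split) /=; apply: eq_bigr => C _.
by ring.
Qed.

Let sum_GA (g : T -> T -> R) (ga gb : T -> R) :
  (forall B, \sum_C g B C = ga B) -> (forall C, \sum_B g B C = gb C) ->
  \sum_B \sum_C g B C * A B C = N ^+ 2 * (\sum_B \sum_C g B C * G B C)
    - N * (\sum_B ga B * a B) - N * (\sum_C gb C * b C)
    - N * (\sum_B \sum_C g B C * (m B * m' C)) + rho * \sum_B ga B.
Proof.
move=> gaE gbE.
have -> : \sum_B ga B * a B = \sum_B \sum_C g B C * a B.
  by apply: eq_bigr => B _; rewrite -gaE mulr_suml.
have -> : \sum_C gb C * b C = \sum_B \sum_C g B C * b C.
  by rewrite exchange_big; apply: eq_bigr => C _; rewrite -gbE mulr_suml.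
have -> : \sum_B ga B = \sum_B \sum_C g B C by apply: eq_bigr => B _; rewrite gaE.
rewrite !mulr_sumr -!(sumrB, big_split) /=; apply: eq_bigr => B _.
rewrite !mulr_sumr -!(sumrB, big_split) /=; apply: eq_bigr => C _.
by rewrite AE; ring.
Qed.

Let sum_AA : \sum_B \sum_C A B C ^+ 2 =
  N ^+ 4 * (\sum_B \sum_C G B C ^+ 2)
  - N ^+ 3 * (\sum_B a B ^+ 2 + \sum_B b B ^+ 2)
  - 2 * N ^+ 3 * (\sum_B \sum_C G B C * (m B * m' C))
  + N ^+ 2 * rho ^+ 2 + N ^+ 2 * ((\sum_B m B ^+ 2) * \sum_B m' B ^+ 2).
Proof.
have EG := sum_GA (fun B => erefl (a B)) (fun C => erefl (b C)).
have Em := @sum_GA (fun B C => m B * m' C) (fun=> 0) (fun=> 0).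
rewrite sum_a in EG.
(* [sum_A_centered] strips one factor, then [sum_GA] expands the other: the marginals are [a] and
   [b] for [G], and 0 for [m B * m' C]. *)
have E : \sum_B \sum_C A B C ^+ 2 = N ^+ 2 * (\sum_B \sum_C G B C * A B C)
   - N * (\sum_B \sum_C m B * m' C * A B C).
  rewrite -(sum_A_centered _ _ (fun B => N * a B - rho) (fun C => N * b C)).
  apply: eq_bigr => B _; apply: eq_bigr => C _.
  by rewrite expr2; congr (_ * _); rewrite AE; ring.
rewrite E EG Em; last 2 first.
- by move=> B; rewrite -mulr_sumr (sum_colsum syP) mulr0.
- by move=> C; rewrite -mulr_suml (sum_colsum sxP) mul0r.
have -> : \sum_B \sum_C m B * m' C * (m B * m' C)
   = (\sum_B m B ^+ 2) * \sum_B m' B ^+ 2.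
  rewrite -double_sum_separable; apply: eq_bigr => B _.
  by apply: eq_bigr => C _; ring.
have -> : \sum_B \sum_C m B * m' C * G B C = \sum_B \sum_C G B C * (m B * m' C).
  by apply: eq_bigr => B _; apply: eq_bigr => C _; ring.
have sqr (f : T -> R) : \sum_B f B * f B = \sum_B f B ^+ 2.
  by apply: eq_bigr => B _; rewrite expr2.
have -> : \sum_B \sum_C G B C * G B C = \sum_B \sum_C G B C ^+ 2.
  by apply: eq_bigr => B _; rewrite sqr.
rewrite !sqr.
rewrite [\sum_B 0 * a B]big1 => [|? _]; last by rewrite mul0r.
rewrite [\sum_B 0 * b B]big1 => [|? _]; last by rewrite mul0r.
rewrite [\sum_B 0]big1 //; ring.
Qed.

Let sum_AA' : \sum_B \sum_C A B C * A C B =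
  N ^+ 4 * (\sum_B \sum_C G B C * G C B)
  - 4 * N ^+ 3 * (\sum_B a B * b B) + 2 * N ^+ 2 * rho ^+ 2.
Proof.
have EG := sum_GA (fun B => erefl (b B)) (fun C => erefl (a C)).
have Em := @sum_GA (fun B C => m C * m' B) (fun=> 0) (fun=> 0).
rewrite sum_b in EG.
have E : \sum_B \sum_C A B C * A C B = N ^+ 2 * (\sum_B \sum_C G C B * A B C)
   - N * (\sum_B \sum_C m C * m' B * A B C).
  rewrite -(sum_A_centered _ _ (fun B => N * b B - rho) (fun C => N * a C)).
  apply: eq_bigr => B _; apply: eq_bigr => C _.
  by congr (_ * _); rewrite AE; ring.
rewrite E EG Em; last 2 first.
- by move=> B; rewrite -mulr_suml (sum_colsum sxP) mul0r.
- by move=> C; rewrite -mulr_sumr (sum_colsum syP) mulr0.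
have -> : \sum_B \sum_C m C * m' B * (m B * m' C) = rho * rho.
  rewrite -double_sum_separable; apply: eq_bigr => B _.
  by apply: eq_bigr => C _; ring.
have -> : \sum_B \sum_C m C * m' B * G B C = \sum_z a z * b z.
  rewrite -G_mm'_swap.
  by apply: eq_bigr => B _; apply: eq_bigr => C _; ring.
have -> : \sum_B \sum_C G C B * (m B * m' C) = \sum_z a z * b z.
  by rewrite -G_mm'_swap exchange_big.
have -> : \sum_B \sum_C G C B * G B C = \sum_B \sum_C G B C * G C B.
  by apply: eq_bigr => B _; apply: eq_bigr => C _; ring.
have -> : \sum_B b B * a B = \sum_B a B * b B.
  by apply: eq_bigr => B _; ring.
rewrite [\sum_B 0 * a B]big1 => [|? _]; last by rewrite mul0r.
rewrite [\sum_B 0 * b B]big1 => [|? _]; last by rewrite mul0r.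
rewrite [\sum_B 0]big1 //; ring.
Qed.

Let sum_A_diag : \sum_B A B B ^+ 2 =
  N ^+ 4 * (\sum_B G B B ^+ 2)
  - 2 * N ^+ 3 * (\sum_B G B B * (a B + b B + m B * m' B))
  + N ^+ 2 * (\sum_B a B ^+ 2 + \sum_B b B ^+ 2 + \sum_B (m B * m' B) ^+ 2
     + 2 * \sum_B a B * b B + 2 * (\sum_B a B * (m B * m' B))
     + 2 * (\sum_B b B * (m B * m' B)))
  + 2 * N ^+ 2 * rho * kappa - 5 * N * rho ^+ 2.
Proof.
have expand (g f h q : T -> R) (r : R) :
    \sum_B (N ^+ 2 * g B - N * f B - N * h B - N * q B + r) ^+ 2 =
    N ^+ 4 * (\sum_B g B ^+ 2) - 2 * N ^+ 3 * (\sum_B g B * (f B + h B + q B))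
    + N ^+ 2 * (\sum_B f B ^+ 2) + N ^+ 2 * (\sum_B h B ^+ 2)
    + N ^+ 2 * (\sum_B q B ^+ 2) + 2 * N ^+ 2 * (\sum_B f B * h B)
    + 2 * N ^+ 2 * (\sum_B f B * q B) + 2 * N ^+ 2 * (\sum_B h B * q B)
    + 2 * N ^+ 2 * r * (\sum_B g B) - 2 * N * r * (\sum_B f B)
    - 2 * N * r * (\sum_B h B) - 2 * N * r * (\sum_B q B) + N * r ^+ 2.
  rewrite -[N * r ^+ 2]sum_const_card !mulr_sumr -!(sumrB, big_split) /=.
  by apply: eq_bigr => B _; ring.
transitivity (\sum_B (N ^+ 2 * G B B - N * a B - N * b B - N * (m B * m' B)
    + rho) ^+ 2); first by apply: eq_bigr => B _; rewrite AE mulrA.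
by rewrite expand sum_a sum_b -/rho -/kappa; ring.
Qed.

(** Each monomial splits into a factor in [z] and one in [w], so the inner double sums are products
    of one-variable sums. The last monomial, summed over [C], supplies the [m B * m' B] that
    completes the linear part of [A B B]. *)
Let sum_rho_kernelE :
  \sum_B \sum_C \sum_z \sum_w rho_kernel B C z w =
  2 * N * (\sum_B G B B ^+ 2) + 2 * kappa ^+ 2
  + 4 * (\sum_B \sum_C G B C ^+ 2) + (\sum_B \sum_C G B C * G C B)
  - 4 * \sum_B G B B * (a B + b B + m B * m' B).
Proof.
have inner B C : \sum_z \sum_w rho_kernel B C z w =
   2 * G B B ^+ 2 + 2 * (G B B * G C C) + 4 * G B C ^+ 2 + G B C * G C B
   - 4 * (G B B * G B C) - 4 * (G B B * G C B) - 4 * (G B B * m B) * sy C B.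
  rewrite !expr2 /G /colsum.
  rewrite -!double_sum_separable ![_ * (\sum_i \sum_j _)]mulr_sumr.
  rewrite mulr_suml -!(sumrB, big_split) /=; apply: eq_bigr => z _.
  rewrite ![_ * (\sum_i _)]mulr_sumr mulr_suml -!(sumrB, big_split) /=.
  by apply: eq_bigr => w _; rewrite /rho_kernel; ring.
under eq_bigr do under eq_bigr do rewrite inner.
have -> : kappa ^+ 2 = \sum_B \sum_C G B B * G C C.
  by rewrite double_sum_separable.
have -> : 4 * (\sum_B G B B * (a B + b B + m B * m' B)) =
   \sum_B \sum_C (4 * (G B B * G B C) + 4 * (G B B * G C B)
       + 4 * (G B B * m B) * sy C B).
  rewrite mulr_sumr; apply: eq_bigr => B _.
  by rewrite !big_split /= -!mulr_sumr -/(a B) -/(b B) -/(m' B); ring.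
have -> : 2 * N * (\sum_B G B B ^+ 2) = \sum_B \sum_(C : T) 2 * G B B ^+ 2.
  by rewrite mulr_sumr; apply: eq_bigr => B _; rewrite sum_const_card; ring.
rewrite !mulr_sumr -!(sumrB, big_split) /=; apply: eq_bigr => B _.
rewrite !mulr_sumr -!(sumrB, big_split) /=; apply: eq_bigr => C _.
by ring.
Qed.

(** The coefficients of [rho_kernel] are such that everything else cancels: the squares of [a] and
    [b] between [sum_A_diag] and [sum_AA], those of [m B * m' B] through [G_mm'], the products
    [a B * b B] between [sum_A_diag] and [sum_AA']. What is left of the column sums is explicit by
    [sum_colsum_sqr]. *)
Lemma sum_rho_kernel :
  N ^+ 4 * \sum_B \sum_C \sum_z \sum_w rho_kernel B C z w =
  2 * N * (\sum_B A B B ^+ 2) + 4 * (\sum_B \sum_C A B C ^+ 2)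
  + (\sum_B \sum_C A B C * A C B)
  + 2 * N ^+ 2 * (N * kappa - rho) ^+ 2 + 2 * N ^+ 2 * rho ^+ 2
  + N ^+ 4 * (2 / 9 * (N ^+ 2 - 1) ^+ 2 - 4 / 3 * (N ^+ 2 - 1)).
Proof.
rewrite sum_rho_kernelE sum_A_diag sum_AA sum_AA' a_parts b_parts.
have GmE : 4 * (\sum_B \sum_C G B C * (m B * m' C)) =
   N * (N ^+ 2 - 1) ^+ 2 - (N ^+ 2 - 1) * (\sum_B m B ^+ 2 + \sum_B m' B ^+ 2)
   + \sum_B (m B * m' B) ^+ 2.
  rewrite G_mm' -[N * (_ ^+ 2)]sum_const_card mulrDr !mulr_sumr.
  rewrite -!(sumrB, big_split) /=; apply: eq_bigr => z _; ring.
have Vx : \sum_B m B ^+ 2 = N * (N ^+ 2 - 1) / 3.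
  by rewrite -(sum_colsum_sqr sxP); field.
have Vy : \sum_B m' B ^+ 2 = N * (N ^+ 2 - 1) / 3.
  by rewrite -(sum_colsum_sqr syP); field.
rewrite Vx Vy in GmE *.
have -> : \sum_B \sum_C G B C * (m B * m' C) = (N * (N ^+ 2 - 1) ^+ 2
   - (N ^+ 2 - 1) * (N * (N ^+ 2 - 1) / 3 + N * (N ^+ 2 - 1) / 3)
   + \sum_B (m B * m' B) ^+ 2) / 4.
  by rewrite -GmE; field.
by field.
Qed.

Lemma sum_rho_kernel_ge :
  3 * (\sum_B \sum_C A B C ^+ 2)
  + N ^+ 4 * (2 / 9 * (N ^+ 2 - 1) ^+ 2 - 4 / 3 * (N ^+ 2 - 1))
  <= N ^+ 4 * \sum_B \sum_C \sum_z \sum_w rho_kernel B C z w.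
Proof.
rewrite sum_rho_kernel.
(* From [0 <= (A B C + A C B) ^+ 2], since exchanging the arguments preserves the sum of squares. *)
have AA' : - \sum_B \sum_C A B C ^+ 2 <= \sum_B \sum_C A B C * A C B.
  have E : \sum_B \sum_C A C B ^+ 2 = \sum_B \sum_C A B C ^+ 2.
    by rewrite exchange_big.
  suff : 0 <= \sum_B \sum_C A B C ^+ 2 + \sum_B \sum_C A C B ^+ 2
      + 2 * \sum_B \sum_C A B C * A C B by rewrite E; lra.
  rewrite mulr_sumr -!big_split /=; apply: sumr_ge0 => B _.
  rewrite mulr_sumr -!big_split /=; apply: sumr_ge0 => C _.
  have -> : A B C ^+ 2 + A C B ^+ 2 + 2 * (A B C * A C B) = (A B C + A C B) ^+ 2.
    by ring.
  exact: sqr_ge0.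
have D0 : 0 <= 2 * N * (\sum_B A B B ^+ 2).
  rewrite !mulr_ge0 ?ler0n // sumr_ge0 // => B _; exact: sqr_ge0.
have K0 : 0 <= 2 * N ^+ 2 * (N * kappa - rho) ^+ 2.
  by rewrite -mulrA mulr_ge0 // mulr_ge0 // sqr_ge0.
have r0 : 0 <= 2 * N ^+ 2 * rho ^+ 2.
  by rewrite -mulrA mulr_ge0 // mulr_ge0 // sqr_ge0.
lra.
Qed.

End TwoKernels.
End SignKernels.

(** * Pattern counts of permutations with small discrepancy *)

(** The relation [r] is a parameter so that positions, ordered by [ord_rel], and values, ordered by
    [pattern_rel], are handled alike. *)
Definition increasing k n (r : rel 'I_k) (x : {ffun 'I_k -> 'I_n}) : bool :=
  [forall i, forall j, r i j ==> (x i < x j)%N].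

Definition pattern_rel k (s : 'S_k) : rel 'I_k := fun i j => (s i < s j)%N.

Lemma increasingP k n (r : rel 'I_k) (x : {ffun 'I_k -> 'I_n}) :
  reflect (forall i j, r i j -> x i < x j)%N (increasing r x).
Proof.
apply: (iffP forallP) => [H i j rij|H i]; first exact: implyP (forallP (H i) j) rij.
by apply/forallP => j; apply/implyP; exact: H.
Qed.

(** * Changing one coordinate of a tuple *)

Section Update.
Variables (k n : nat).
Implicit Types (x : {ffun 'I_k -> 'I_n}) (j : 'I_k) (a : 'I_n).

Definition upd x j a : {ffun 'I_k -> 'I_n} := [ffun i => if i == j then a else x i].

(** The map sending [(x, a)] to [(upd x j a, x j)] is an involution, so each tuple is reached [n]
    times. *)
Lemma sum_upd (V : nmodType) j (F : {ffun 'I_k -> 'I_n} -> V) :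
  \sum_x \sum_a F (upd x j a) = (\sum_x F x) *+ n.
Proof.
rewrite pair_big /= (reindex_inj (h := fun u => (upd u.1 j u.2, u.1 j))) /=; last first.
  apply: inv_inj => -[x a] /=; congr pair; last by rewrite ffunE eqxx.
  by apply/ffunP => i; rewrite !ffunE; case: eqP => // ->.
transitivity (\sum_(u : {ffun 'I_k -> 'I_n} * 'I_n) F u.1).
  apply: eq_bigr => -[x a] _ /=; congr F; apply/ffunP => i.
  by rewrite !ffunE; case: eqP => // ->.
rewrite -(pair_big xpredT xpredT (fun x a => F x)) /= -sumrMnl.
by apply: eq_bigr => x _; rewrite sumr_const card_ord.
Qed.

Variables (r : rel 'I_k) (r_irr : irreflexive r).

Lemma increasing_upd x j a : increasing r (upd x j a) =
  [forall i, forall i', (i != j) && (i' != j) && r i i' ==> (x i < x i')%N]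
  && ([forall i, r i j ==> (x i < a)%N] && [forall i, r j i ==> (a < x i)%N]).
Proof.
apply/increasingP/and3P => [H|[/forallP H1 /forallP H2 /forallP H3] i i' rii'].
  split.
  - apply/forallP => i; apply/forallP => i'; apply/implyP => /andP[/andP[ij i'j] rii'].
    by have := H _ _ rii'; rewrite !ffunE (negbTE ij) (negbTE i'j).
  - apply/forallP => i; apply/implyP => rij; have := H _ _ rij.
    by rewrite !ffunE eqxx; case: eqP => // ij; rewrite ij r_irr in rij.
  - apply/forallP => i; apply/implyP => rij; have := H _ _ rij.
    by rewrite !ffunE eqxx; case: eqP => // ij; rewrite ij r_irr in rij.
rewrite !ffunE; case: eqP => [ij|/eqP ij]; case: eqP => [i'j|/eqP i'j].
- by rewrite ij i'j r_irr in rii'.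
- by apply: (implyP (H3 _)); rewrite -ij.
- by apply: (implyP (H2 _)); rewrite -i'j.
- by apply: (implyP (forallP (H1 i) i')); rewrite ij i'j.
Qed.

Lemma increasing_upd_interval x j : exists u v : nat,
  [/\ (u <= n)%N, (v <= n)%N & exists c : bool, forall a,
     increasing r (upd x j a) = c && (u <= a < v)%N].
Proof.
(* The lower end exceeds every [x i] that must lie below. The upper end is the minimum of the [x i]
   that must lie above, written with a maximum so that it is [n] when there are none. *)
exists (\max_(i | r i j) (x i).+1), (n - \max_(i | r j i) (n - x i))%N.
split; [by apply/bigmax_leqP | exact: leq_subr |].
eexists => a; rewrite increasing_upd; congr (_ && (_ && _)).
  by apply/forallP/bigmax_leqP => [H i|H i]; [apply/implyP | apply/implyP/H].
apply/forallP/idP => [H|H i].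
  suff : (\max_(i | r j i) (n - x i) <= n - a.+1)%N by have := ltn_ord a; lia.
  apply/bigmax_leqP => i rji; have := implyP (H i) rji; lia.
apply/implyP => rji.
have : (\max_(i | r j i) (n - x i) <= n - a.+1)%N by have := ltn_ord a; lia.
by move/bigmax_leqP => /(_ i rji); have := ltn_ord (x i); have := ltn_ord a; lia.
Qed.

End Update.

(** * Replacing the points of the permutation by uniform points *)

Section Counting.
Variables (R : realFieldType) (k n : nat).

Lemma ltn_max_sub (u v a : nat) :
  ((u <= a) && (a < v))%N%:R = ((a < maxn u v)%N)%:R - ((a < u)%N)%:R :> R.
Proof.
rewrite leq_max; case: (ltnP a u) => au /=; first by rewrite subrr.
by rewrite subr0.
Qed.

(** A box is a signed combination of four boxes with a corner at the origin, which gives the factor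
    4. *)
Lemma rectangle_discrepancy (w : 'I_n -> 'I_n -> R) (d : R) :
  (forall u v, (u <= n)%N -> (v <= n)%N ->
    `|\sum_(a < n) \sum_(b < n) ((a < u)%N)%:R * ((b < v)%N)%:R * w a b| <= d) ->
  forall u u' v v' (c c' : bool),
  (u <= n)%N -> (u' <= n)%N -> (v <= n)%N -> (v' <= n)%N ->
   `|\sum_(a < n) \sum_(b < n)
       (c && (u <= a < u')%N)%:R * (c' && (v <= b < v')%N)%:R * w a b| <= 4 * d.
Proof.
move=> wd u u' v v' c c' un u'n vn v'n.
have d0 : 0 <= d by apply: le_trans (wd 0%N 0%N _ _).
case: c; last first.
  rewrite big1 ?normr0 ?mulr_ge0 // => a _.
  by rewrite big1 // => b _; rewrite !mul0r.
case: c'; last first.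
  rewrite big1 ?normr0 ?mulr_ge0 // => a _.
  by rewrite big1 // => b _; rewrite mulr0 mul0r.
set D := fun u v : nat =>
  \sum_(a < n) \sum_(b < n) ((a < u)%N)%:R * ((b < v)%N)%:R * w a b.
set U := maxn u u'; set V := maxn v v'.
have Un : (U <= n)%N by rewrite geq_max un.
have Vn : (V <= n)%N by rewrite geq_max vn.
rewrite (_ : \sum_(a < n) _ = D U V - D u V - D U v + D u v).
  have : `|D U V| <= d := wd _ _ Un Vn.
  have : `|D u V| <= d := wd _ _ un Vn.
  have : `|D U v| <= d := wd _ _ Un vn.
  have : `|D u v| <= d := wd _ _ un vn.
  rewrite !ler_norml => /andP[? ?] /andP[? ?] /andP[? ?] /andP[? ?].
  by apply/andP; split; lra.
rewrite -!(sumrB, big_split) /=; apply: eq_bigr => a _.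
rewrite -!(sumrB, big_split) /=; apply: eq_bigr => b _.
by rewrite !ltn_max_sub; ring.
Qed.

Lemma sum_prod_ffun2 (F : 'I_k -> 'I_n -> 'I_n -> R) :
  \sum_(x : {ffun 'I_k -> 'I_n}) \sum_(y : {ffun 'I_k -> 'I_n})
    \prod_i F i (x i) (y i) = \prod_i \sum_a \sum_b F i a b.
Proof.
rewrite bigA_distr_bigA /=; apply: eq_bigr => x _.
by rewrite bigA_distr_bigA.
Qed.

Variables (p : 'S_n) (r r' : rel 'I_k).
Hypothesis r_irr : irreflexive r.
Hypothesis r'_irr : irreflexive r'.

(** Both [mu], carried by the graph of [p], and the uniform [lam] have total mass [n] when [n > 0].
    In [hybrid t] the first [t] points have weight [mu] and the others [lam]. *)
Let mu (a b : 'I_n) : R := (p a == b)%:R.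
Let lam (a b : 'I_n) : R := n%:R^-1.
Let wt (t : nat) (i : 'I_k) := if (i < t)%N then mu else lam.
Let hybrid (t : nat) : R := \sum_x \sum_y
  (increasing r x)%:R * (increasing r' y)%:R * \prod_i wt t i (x i) (y i).

Let sum_mu : \sum_a \sum_b mu a b = n%:R.
Proof.
rewrite (eq_bigr (fun=> 1)) ?sumr_const ?card_ord // => a _.
rewrite (bigD1 (p a)) //= /mu eqxx big1 ?addr0 // => b /negbTE.
by rewrite eq_sym => ->.
Qed.

Let sum_lam : (0 < n)%N -> \sum_a \sum_b lam a b = n%:R.
Proof.
move=> n0; rewrite (eq_bigr (fun=> 1)) ?sumr_const ?card_ord // => a _.
rewrite sumr_const card_ord /lam -(mulr_natl (n%:R^-1)) mulfV //.
by rewrite pnatr_eq0 -lt0n.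
Qed.

Let wt_ge0 t i a b : 0 <= wt t i a b.
Proof. by rewrite /wt; case: ifP; rewrite ?/mu ?/lam ?invr_ge0 ?ler0n. Qed.

(** Only point [j] changes its weight. With the others fixed it ranges over a box, where
    [rectangle_discrepancy] applies; the others have total mass [n ^ (k - 1)]. *)
Let hybrid_step (d : R) (j : 'I_k) : (0 < n)%N ->
  (forall u v, (u <= n)%N -> (v <= n)%N ->
    `|\sum_(a < n) \sum_(b < n) ((a < u)%N)%:R * ((b < v)%N)%:R
        * (mu a b - lam a b)| <= d) ->
  `|hybrid j.+1 - hybrid j| <= 4 * d * n%:R ^+ k.-1.
Proof.
move=> n0 wd.
have nR : 0 < n%:R :> R by rewrite ltr0n.
pose rest (x y : {ffun 'I_k -> 'I_n}) := \prod_(i | i != j) wt j i (x i) (y i).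
have step x y :
    (increasing r x)%:R * (increasing r' y)%:R * \prod_i wt j.+1 i (x i) (y i)
    - (increasing r x)%:R * (increasing r' y)%:R * \prod_i wt j i (x i) (y i)
    = (increasing r x)%:R * (increasing r' y)%:R
      * (mu (x j) (y j) - lam (x j) (y j)) * rest x y.
  rewrite (bigD1 j) //= [X in _ - _ * X](bigD1 j) //= /wt ltnSn ltnn.
  have -> : \prod_(i | i != j) (if (i < j.+1)%N then mu else lam) (x i) (y i)
     = rest x y.
    apply: eq_bigr => i ij; rewrite /wt ltnS leq_eqVlt.
    by rewrite (_ : (i == j :> nat) = false) //; apply/negbTE.
  by rewrite -/(rest x y) /=; ring.
have rest_upd x y a b : rest (upd x j a) (upd y j b) = rest x y.
  by apply: eq_bigr => i /negbTE ij; rewrite !ffunE ij.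
pose F x y := (increasing r x)%:R * (increasing r' y)%:R
  * (mu (x j) (y j) - lam (x j) (y j)) * rest x y.
have diffE : hybrid j.+1 - hybrid j = \sum_x \sum_y F x y.
  rewrite /hybrid -sumrB; apply: eq_bigr => x _.
  by rewrite -sumrB; apply: eq_bigr => y _; exact: step.
(* Resampling the coordinate [j] of both [x] and [y] exposes the sum over a box and counts every
   pair [n ^ 2] times. *)
have avg : n%:R ^+ 2 * (\sum_x \sum_y F x y)
   = \sum_x \sum_y \sum_a \sum_b F (upd x j a) (upd y j b).
  rewrite expr2 -mulrA !(mulr_natl _ n) -sumrMnl.
  under eq_bigr do rewrite -(sum_upd j).
  rewrite -(sum_upd j (fun x => \sum_y \sum_b F x (upd y j b))).
  by apply: eq_bigr => x _; rewrite exchange_big.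
(* The coordinates [j] of [x] and [y] are free and contribute [n ^ 2]; each of the other [k - 1]
   points contributes the total mass [n]. *)
have restE : \sum_x \sum_y rest x y = n%:R ^+ 2 * n%:R ^+ k.-1.
  transitivity (\sum_(x : {ffun 'I_k -> 'I_n}) \sum_(y : {ffun 'I_k -> 'I_n}) \prod_i
      (if i == j then fun _ _ => 1 else wt j i) (x i) (y i)).
    apply: eq_bigr => x _; apply: eq_bigr => y _.
    rewrite [RHS](bigD1 j) //= eqxx mul1r; apply: eq_bigr => i /negbTE -> //.
  rewrite (sum_prod_ffun2 (fun i => if i == j then fun _ _ => 1 else wt j i)).
  rewrite (bigD1 j) //= eqxx; congr (_ * _).
    by rewrite !(sumr_const, card_ord) -mulrnA natrM expr2.
  rewrite (eq_bigr (fun=> n%:R)) => [|i /negbTE ->]; last first.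
    by rewrite /wt; case: ifP => _; [exact: sum_mu | exact: sum_lam].
  rewrite prodr_const; congr (_ ^+ _).
  have := cardC1 j; rewrite card_ord => <-.
  by apply: eq_card => i; rewrite !inE.
have key : `|\sum_x \sum_y \sum_a \sum_b F (upd x j a) (upd y j b)|
     <= \sum_x \sum_y rest x y * (4 * d).
  apply: le_trans (ler_norm_sum _ _ _) _; apply: ler_sum => x _.
  apply: le_trans (ler_norm_sum _ _ _) _; apply: ler_sum => y _.
  have [u [u' [un u'n [c cE]]]] := increasing_upd_interval r_irr x j.
  have [v [v' [vn v'n [c' c'E]]]] := increasing_upd_interval r'_irr y j.
  have rect := rectangle_discrepancy wd c c' un u'n vn v'n.
  have -> : \sum_a \sum_b F (upd x j a) (upd y j b) = rest x y *
     \sum_(a < n) \sum_(b < n)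
       (c && (u <= a < u')%N)%:R * (c' && (v <= b < v')%N)%:R * (mu a b - lam a b).
    rewrite mulr_sumr; apply: eq_bigr => a _; rewrite mulr_sumr; apply: eq_bigr => b _.
    by rewrite /F cE c'E rest_upd !ffunE eqxx; ring.
  have rest0 : 0 <= rest x y by apply: prodr_ge0 => i _; exact: wt_ge0.
  by rewrite normrM (ger0_norm rest0) ler_wpM2l.
rewrite -avg in key.
have key2 : n%:R ^+ 2 * `|\sum_x \sum_y F x y| <= n%:R ^+ 2 * (4 * d * n%:R ^+ k.-1).
  have -> : n%:R ^+ 2 * `|\sum_x \sum_y F x y| = `|n%:R ^+ 2 * \sum_x \sum_y F x y|.
    by rewrite normrM ger0_norm // exprn_ge0.
  apply: le_trans key _; under eq_bigr do rewrite -mulr_suml.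
  by rewrite -mulr_suml restE le_eqVlt; apply/orP; left; apply/eqP; ring.
by rewrite diffE -(ler_pM2l (exprn_gt0 2 nR)).
Qed.

Let hybrid_total (d : R) : (0 < n)%N ->
  (forall u v, (u <= n)%N -> (v <= n)%N ->
    `|\sum_(a < n) \sum_(b < n) ((a < u)%N)%:R * ((b < v)%N)%:R
        * (mu a b - lam a b)| <= d) ->
  `|hybrid k - hybrid 0| <= k%:R * (4 * d * n%:R ^+ k.-1).
Proof.
move=> n0 wd; suff : forall t, (t <= k)%N ->
    `|hybrid t - hybrid 0| <= t%:R * (4 * d * n%:R ^+ k.-1) by exact.
elim=> [|t IH] tk; first by rewrite subrr normr0 mul0r.
rewrite -addn1 natrD mulrDl mul1r addn1.
have -> : hybrid t.+1 - hybrid 0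
    = (hybrid t.+1 - hybrid t) + (hybrid t - hybrid 0) by ring.
apply: le_trans (ler_normD _ _) _; rewrite addrC; apply: lerD; first exact/IH/ltnW.
exact: (@hybrid_step d (Ordinal tk) n0 wd).
Qed.

Let hybrid_last : hybrid k =
  \sum_x (increasing r x && increasing r' [ffun i => p (x i)])%:R.
Proof.
apply: eq_bigr => x _.
rewrite (bigD1 [ffun i => p (x i)]) //= [X in _ + X]big1 => [|y yx].
  rewrite addr0 -natrM mulnb big1 ?mulr1 // => i _.
  by rewrite /wt ltn_ord /mu ffunE eqxx.
have [i yi] : exists i, y i != p (x i).
  apply/existsP; rewrite -negb_forall; apply: contra yx => /forallP H.
  by apply/eqP/ffunP => i; rewrite ffunE; apply/eqP.
by rewrite (bigD1 i) //= /wt ltn_ord /mu eq_sym (negbTE yi) mul0r mulr0.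
Qed.

Let hybrid0 : hybrid 0 =
  (\sum_(x : {ffun 'I_k -> 'I_n}) (increasing r x)%:R)
  * (\sum_(y : {ffun 'I_k -> 'I_n}) (increasing r' y)%:R) / n%:R ^+ k.
Proof.
rewrite 2!mulr_suml; apply: eq_bigr => x _.
rewrite mulr_sumr mulr_suml; apply: eq_bigr => y _; congr (_ * _).
by rewrite prodr_const card_ord exprVn.
Qed.

Lemma increasing_discrepancy (d : R) : (0 < n)%N ->
  (forall u v, (u <= n)%N -> (v <= n)%N ->
    `|\sum_(a < n) \sum_(b < n) ((a < u)%N)%:R * ((b < v)%N)%:R
        * ((p a == b)%:R - n%:R^-1)| <= d) ->
  `|(\sum_x (increasing r x && increasing r' [ffun i => p (x i)])%:R)
    - (\sum_(x : {ffun 'I_k -> 'I_n}) (increasing r x)%:R)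
      * (\sum_(y : {ffun 'I_k -> 'I_n}) (increasing r' y)%:R) / n%:R ^+ k|
  <= k%:R * (4 * d * n%:R ^+ k.-1).
Proof. by move=> n0 pd; rewrite -hybrid_last -hybrid0; exact: hybrid_total. Qed.

End Counting.

(** * Copies as increasing maps *)

Definition ord_rel k : rel 'I_k := fun i j => (i < j)%N.

Lemma increasing_sorted k n (x : {ffun 'I_k -> 'I_n}) :
  increasing (@ord_rel k) x = sorted ltn (map val [tuple x i | i < k]).
Proof.
apply/increasingP/idP => [H|].
  rewrite sorted_pairwise; last exact: ltn_trans.
  apply/(pairwiseP 0%N) => i j; rewrite !inE size_map size_tuple => ik jk ij.
  have i0 : 'I_n by exact: x (Ordinal ik).
  rewrite !(nth_map i0) ?size_tuple //.
  rewrite -[i]/(val (Ordinal ik)) -[j]/(val (Ordinal jk)) -!tnth_nth !tnth_mktuple.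
  exact: H.
rewrite sorted_pairwise; last exact: ltn_trans.
move/(pairwiseP 0%N) => H i j ij.
have := H i j; rewrite !inE size_map size_tuple !(nth_map (x i)) ?size_tuple //.
by rewrite -!tnth_nth !tnth_mktuple; apply.
Qed.

Lemma card_increasing k n :
  #|[set x : {ffun 'I_k -> 'I_n} | increasing (@ord_rel k) x]| = 'C(n, k).
Proof.
rewrite -card_ltn_sorted_tuples.
pose f (x : {ffun 'I_k -> 'I_n}) := [tuple x i | i < k].
have f_inj : injective f.
  move=> x y xy; apply/ffunP => i.
  by have := congr1 (fun t => tnth t i) xy; rewrite !tnth_mktuple.
rewrite -(card_imset _ f_inj); apply: eq_card => t; rewrite inE.
apply/imsetP/idP => [[x]|tS]; first by rewrite inE increasing_sorted => xS ->.
have tE : t = f [ffun i => tnth t i].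
  by apply: eq_from_tnth => i; rewrite tnth_mktuple ffunE.
by exists [ffun i => tnth t i] => //; rewrite inE increasing_sorted -/(f _) -tE.
Qed.

(** Precomposition with [s] is a bijection from the increasing maps to those with pattern [s]. *)
Lemma card_increasing_pattern k n (s : 'S_k) :
  #|[set x : {ffun 'I_k -> 'I_n} | increasing (pattern_rel s) x]| = 'C(n, k).
Proof.
rewrite -card_increasing.
pose f (x : {ffun 'I_k -> 'I_n}) := [ffun i => x (s i)].
have f_inj : injective f.
  move=> x y /ffunP xy; apply/ffunP => i.
  by have := xy (s^-1 i)%g; rewrite !ffunE permKV.
rewrite -[RHS](card_imset _ f_inj); apply: eq_card => x; rewrite inE.
apply/increasingP/imsetP => [H|[y]]; last first.
  by rewrite inE => /increasingP H -> i j sij; rewrite !ffunE; exact: H.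
exists [ffun i => x (s^-1 i)%g]; last first.
  by apply/ffunP => i; rewrite !ffunE permK.
rewrite inE; apply/increasingP => i j ij; rewrite !ffunE.
by apply: H; rewrite /pattern_rel !permKV.
Qed.

(** The one-sided condition implies the equivalence required by [copy], by trichotomy of the values
    of [s]. *)
Lemma increasing_patternE k n (s : 'S_k) (y : {ffun 'I_k -> 'I_n}) :
  [forall i, forall j, (y i < y j)%N == (s i < s j)%N]
  = increasing (pattern_rel s) y.
Proof.
apply/forallP/increasingP => [H i j sij|H i].
  by rewrite (eqP (forallP (H i) j)).
apply/forallP => j; apply/eqP; case: (ltngtP (s i) (s j)) => sij.
- exact: H.
- by apply/negbTE; rewrite -leqNgt ltnW // H.
- by rewrite (perm_inj (val_inj sij)) ltnn.
Qed.

Lemma increasing_image_inj k n (x y : {ffun 'I_k -> 'I_n}) :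
  increasing (@ord_rel k) x -> increasing (@ord_rel k) y ->
  [set x i | i : 'I_k]%SET = [set y i | i : 'I_k]%SET -> x = y.
Proof.
rewrite !increasing_sorted => xS yS xy.
have E : map val [tuple x i | i < k] = map val [tuple y i | i < k] :> seq nat.
  apply: (irr_sorted_eq ltn_trans ltnn xS yS) => a.
  have memE (z : {ffun 'I_k -> 'I_n}) : (a \in map val [tuple z i | i < k]) =
     (a \in map val (enum [set z i | i : 'I_k]%SET)).
    apply/mapP/mapP => -[b bz ->]; exists b => //; move: bz.
      by move/tnthP => [i ->]; rewrite tnth_mktuple mem_enum imset_f.
    by rewrite mem_enum => /imsetP[i _ ->]; rewrite map_f ?mem_enum.
  by rewrite !memE xy.
have /val_inj E2 := inj_map val_inj E.
by apply/ffunP => i; have := congr1 (fun t => tnth t i) E2; rewrite !tnth_mktuple.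
Qed.

Lemma card_copy k n (s : 'S_k) (p : 'S_n) : #|copy s p| =
  #|[set x : {ffun 'I_k -> 'I_n} | increasing (@ord_rel k) x
      && increasing (pattern_rel s) [ffun i => p (x i)]]|.
Proof.
set X := [set x | _].
pose f (x : {ffun 'I_k -> 'I_n}) := [set x i | i : 'I_k]%SET.
have f_inj : {in X &, injective f}.
  by move=> x y; rewrite !inE => /andP[? _] /andP[? _]; exact: increasing_image_inj.
rewrite -(card_in_imset f_inj); apply: eq_card => A.
rewrite -topredE /= /copy; apply/existsP/imsetP => -[x].
  case/and3P => xi /eqP -> xs; exists x => //; rewrite inE; apply/andP; split=> //.
  by rewrite -increasing_patternE; under eq_forallb do under eq_forallb do rewrite !ffunE.
rewrite inE => /andP[xi xs] ->; exists x; apply/and3P; split => //.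
move: xs; rewrite -increasing_patternE.
by under eq_forallb do under eq_forallb do rewrite !ffunE.
Qed.

Definition quadrant n (p : 'S_n) (u v : nat) : nat :=
  #|[set z : 'I_n | (z < u)%N && (p z < v)%N]|.

Lemma sum_bool_card (R : pzSemiRingType) (T : finType) (P : pred T) :
  \sum_(x : T) (P x)%:R = #|[set x | P x]|%:R :> R.
Proof.
rewrite -sum1_card natr_sum big_mkcond [RHS]big_mkcond; apply: eq_bigr => x _.
by rewrite inE; case: (P x).
Qed.

Lemma card_ltn_ord n u : (u <= n)%N -> #|[set a : 'I_n | (a < u)%N]| = u.
Proof.
move=> un.
have w_inj : injective (widen_ord un) by move=> i j /(congr1 val) /= /val_inj.
rewrite -[RHS](card_ord u) -(card_imset _ w_inj).
apply: eq_card => a; rewrite inE; apply/idP/imsetP => [au|[b _ ->]]; last exact: (ltn_ord b).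
by exists (Ordinal au) => //; apply: val_inj.
Qed.

(** The main term is the count for uniform points of the square: ['C(n, k)] position tuples times
    ['C(n, k)] value tuples, each pair having weight [n ^ (- k)]. *)
Lemma counting_lemma (R : realFieldType) k n (s : 'S_k) (p : 'S_n) (d : R) :
  (0 < n)%N ->
  (forall u v, (u <= n)%N -> (v <= n)%N ->
     `|(quadrant p u v)%:R - u%:R * v%:R / n%:R| <= d) ->
  `|#|copy s p|%:R - 'C(n, k)%:R ^+ 2 / n%:R ^+ k|
    <= k%:R * (4 * d * n%:R ^+ k.-1).
Proof.
move=> n0 pd.
rewrite card_copy expr2 -{1}(card_increasing k n) -(card_increasing_pattern n s).
have ord_irr : irreflexive (@ord_rel k) by move=> i; exact: ltnn.
have s_irr : irreflexive (pattern_rel s) by move=> i; exact: ltnn.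
rewrite -!sum_bool_card; apply: (increasing_discrepancy ord_irr s_irr n0).
move=> u v un vn; have := pd _ _ un vn.
suff -> : \sum_(a < n) \sum_(b < n) (a < u)%:R * (b < v)%:R * ((p a == b)%:R - n%:R^-1)
   = (quadrant p u v)%:R - u%:R * v%:R / n%:R :> R by [].
rewrite /quadrant -sum_bool_card -[in u%:R](card_ltn_ord un) -[in v%:R](card_ltn_ord vn).
rewrite -!sum_bool_card !mulr_suml -sumrB; apply: eq_bigr => a _.
rewrite mulr_sumr mulr_suml.
transitivity (\sum_(b < n) (a < u)%:R * (b < v)%:R * (p a == b)%:R
  - \sum_(b < n) (a < u)%:R * (b < v)%:R / n%:R : R).
  by rewrite -sumrB; apply: eq_bigr => b _; rewrite mulrBr.
congr (_ - _); rewrite (bigD1 (p a)) //= eqxx mulr1 big1 ?addr0 => [|b /negbTE].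
  by rewrite -natrM mulnb.
by rewrite eq_sym => ->; rewrite mulr0.
Qed.

(** * The density of rho* as a sum of signs *)

Section OrderSign.
Variable (R : realFieldType).

Definition order_sign (i j : nat) : R := ((i < j)%N)%:R - ((j < i)%N)%:R.

Lemma order_sign_kernel (T : finType) (f : T -> nat) : injective f ->
  sign_kernel (fun i j => order_sign (f i) (f j)).
Proof.
move=> f_inj i j l; rewrite /order_sign -(inj_eq f_inj i j) -(inj_eq f_inj i l).
split; first by rewrite opprB.
case: (ltngtP (f i) (f j)) => ij; case: (ltngtP (f i) (f l)) => il;
  case: (ltngtP (f j) (f l)) => jl; try lia; by rewrite /=; ring.
Qed.

End OrderSign.

(** * Fourfold sums and their symmetrization *)

Section FourfoldSums.
Variables (R : realFieldType) (n : nat).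
Local Notation I := 'I_n.
Local Notation fun4 := (I -> I -> I -> I -> R).
Implicit Types F G : fun4.

Definition sum4 F : R := \sum_a \sum_b \sum_c \sum_d F a b c d.

Lemma eq_sum4 F G : (forall a b c d, F a b c d = G a b c d) -> sum4 F = sum4 G.
Proof. by move=> FG; do 4 (apply: eq_bigr => ? _). Qed.

Lemma sum4D F G : sum4 (fun a b c d => F a b c d + G a b c d) = sum4 F + sum4 G.
Proof. by rewrite /sum4 -big_split; do 3 (apply: eq_bigr => ? _; rewrite -big_split). Qed.

Lemma sum4Z x F : sum4 (fun a b c d => x * F a b c d) = x * sum4 F.
Proof. by rewrite /sum4 mulr_sumr; do 3 (apply: eq_bigr => ? _; rewrite mulr_sumr). Qed.

Lemma ler_sum4 F G : (forall a b c d, F a b c d <= G a b c d) -> sum4 F <= sum4 G.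
Proof. by move=> FG; do 4 (apply: ler_sum => ? _). Qed.

Lemma sum4_ab F : sum4 F = sum4 (fun a b c d => F b a c d).
Proof. by rewrite /sum4 exchange_big. Qed.

Lemma sum4_bc F : sum4 F = sum4 (fun a b c d => F a c b d).
Proof. by apply: eq_bigr => a _; rewrite exchange_big. Qed.

Lemma sum4_cd F : sum4 F = sum4 (fun a b c d => F a b d c).
Proof. by do 2 (apply: eq_bigr => ? _); rewrite exchange_big. Qed.

Lemma sum4_ac F : sum4 F = sum4 (fun a b c d => F c b a d).
Proof. by rewrite sum4_ab sum4_bc sum4_ab. Qed.

Lemma sum4_bd F : sum4 F = sum4 (fun a b c d => F a d c b).
Proof. by rewrite sum4_bc sum4_cd sum4_bc. Qed.

Lemma sum4_ad F : sum4 F = sum4 (fun a b c d => F d b c a).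
Proof. by rewrite sum4_ab sum4_bd sum4_ab. Qed.

(* The composite of the three operators sums over the 24 permutations of the
   arguments, factored through coset representatives of S_2 < S_3 < S_4. *)
Definition sym2 F : fun4 := fun a b c d => F a b c d + F b a c d.
Definition sym3 F : fun4 := fun a b c d => F a b c d + F c b a d + F a c b d.
Definition sym4 F : fun4 :=
  fun a b c d => F a b c d + F d b c a + F a d c b + F a b d c.

Definition mul4 F G : fun4 := fun a b c d => F a b c d * G a b c d.

(** Transpositions are involutions preserving [sum4], so [sym2], and likewise [sym3] and [sym4], is
    self-adjoint for the pairing [sum4 (mul4 F G)]. *)
Lemma sum4_sym2 F G : sum4 (mul4 (sym2 F) G) = sum4 (mul4 F (sym2 G)).
Proof.
transitivity (sum4 (mul4 F G) + sum4 (fun a b c d => F b a c d * G a b c d)).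
  by rewrite -sum4D; apply: eq_sum4 => a b c d; rewrite /mul4 /sym2; ring.
rewrite [X in _ + X]sum4_ab -sum4D; apply: eq_sum4 => a b c d.
by rewrite /mul4 /sym2; ring.
Qed.

Lemma sum4_sym3 F G : sum4 (mul4 (sym3 F) G) = sum4 (mul4 F (sym3 G)).
Proof.
transitivity (sum4 (mul4 F G) + sum4 (fun a b c d => F c b a d * G a b c d)
   + sum4 (fun a b c d => F a c b d * G a b c d)).
  by rewrite -!sum4D; apply: eq_sum4 => a b c d; rewrite /mul4 /sym3; ring.
rewrite [X in _ + X]sum4_bc [X in _ + X + _]sum4_ac -!sum4D.
by apply: eq_sum4 => a b c d; rewrite /mul4 /sym3; ring.
Qed.

Lemma sum4_sym4 F G : sum4 (mul4 (sym4 F) G) = sum4 (mul4 F (sym4 G)).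
Proof.
transitivity (sum4 (mul4 F G) + sum4 (fun a b c d => F d b c a * G a b c d)
   + sum4 (fun a b c d => F a d c b * G a b c d)
   + sum4 (fun a b c d => F a b d c * G a b c d)).
  by rewrite -!sum4D; apply: eq_sum4 => a b c d; rewrite /mul4 /sym4; ring.
rewrite [X in _ + X]sum4_cd [X in _ + X + _]sum4_bd [X in _ + X + _ + _]sum4_ad.
by rewrite -!sum4D; apply: eq_sum4 => a b c d; rewrite /mul4 /sym4; ring.
Qed.

Definition chain4 : fun4 := fun a b c d => ((a < b) && (b < c) && (c < d))%N%:R.

(** On distinct entries exactly one of the 24 relabelings is increasing; otherwise none is, and the
    defect 1 is at most the number of coinciding pairs. *)
Lemma sym_chain4 a b c d :
  0 <= 1 - sym4 (sym3 (sym2 chain4)) a b c d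
    <= (a == b)%:R + (a == c)%:R + (a == d)%:R
       + (b == c)%:R + (b == d)%:R + (c == d)%:R.
Proof.
rewrite -!(inj_eq val_inj) /= /sym4 /sym3 /sym2 /chain4.
move: (val a) (val b) (val c) (val d) => {}a {}b {}c {}d.
by case: (ltngtP a b) => ab; case: (ltngtP b c) => bc; case: (ltngtP c d) => cd;
   case: (ltngtP a c) => ac; try lia;
   case: (ltngtP b d) => bd; try lia; case: (ltngtP a d) => ad; try lia;
   rewrite /=; apply/andP; split; lra.
Qed.

Lemma sum_eq_ord (a : I) : \sum_b (a == b)%:R = 1 :> R.
Proof.
rewrite (bigD1 a) //= eqxx big1 ?addr0 // => b /negbTE.
by rewrite eq_sym => ->.
Qed.

Lemma sum4_coincidences : sum4 (fun a b c d => (a == b)%:R + (a == c)%:R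
  + (a == d)%:R + (b == c)%:R + (b == d)%:R + (c == d)%:R) = 6 * n%:R ^+ 3.
Proof.
have E : sum4 (fun a b c d => (c == d)%:R) = n%:R ^+ 3.
  rewrite /sum4; under eq_bigr do under eq_bigr do under eq_bigr do rewrite sum_eq_ord.
  by rewrite !sumr_const card_ord -!mulrnA -natrX !expnS expn0 muln1 !mulnA.
rewrite !sum4D.
rewrite (sum4_bc (fun a b c d => (b == d)%:R)) E.
rewrite (sum4_bd (fun a b c d => (b == c)%:R)).
rewrite (_ : sum4 (fun a b c d => (d == c)%:R) = n%:R ^+ 3); last first.
  by rewrite -E; apply: eq_sum4 => a b c d; rewrite eq_sym.
rewrite (sum4_ac (fun a b c d => (a == d)%:R)) E.
rewrite (sum4_ad (fun a b c d => (a == c)%:R)).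
rewrite (_ : sum4 (fun a b c d => (d == c)%:R) = n%:R ^+ 3); last first.
  by rewrite -E; apply: eq_sum4 => a b c d; rewrite eq_sym.
rewrite (sum4_ac (fun a b c d => (a == b)%:R)) sum4_bd.
rewrite (_ : sum4 (fun a b c d => (c == d)%:R) = n%:R ^+ 3) //; ring.
Qed.

(* Only quadruples with a repeated entry are lost when a fourfold sum is
   restricted to increasing quadruples. *)
Lemma sum4_chain F K : (forall a b c d, `|F a b c d| <= K) ->
  `|sum4 F - sum4 (mul4 chain4 (sym2 (sym3 (sym4 F))))| <= K * (6 * n%:R ^+ 3).
Proof.
(* Self-adjointness moves the symmetrization from [F] onto [chain4], where [sym_chain4] applies. *)
move=> FK; rewrite -sum4_sym2 -sum4_sym3 -sum4_sym4.
set Ch := sym4 _.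
have -> : sum4 F - sum4 (mul4 Ch F) = sum4 (fun a b c d => (1 - Ch a b c d) * F a b c d).
  rewrite -[- sum4 _]mulN1r -sum4Z -sum4D; apply: eq_sum4 => a b c d.
  by rewrite /mul4; ring.
rewrite -sum4_coincidences -sum4Z.
apply: (@le_trans _ _ (sum4 (fun a b c d => `|(1 - Ch a b c d) * F a b c d|))).
  by rewrite /sum4; do 3 (apply: le_trans (ler_norm_sum _ _ _) _;
     apply: ler_sum => ? _); exact: ler_norm_sum.
apply: ler_sum4 => a b c d; rewrite normrM mulrC.
have /andP[Ch0 Ch1] := sym_chain4 a b c d.
by apply: ler_pM => //; rewrite ger0_norm.
Qed.

End FourfoldSums.

(** * The symmetrized kernel as a combination of patterns *)

Section PatternKernel.
Variables (R : realFieldType) (n : nat) (p : 'S_n).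
Local Notation I := 'I_n.
Implicit Types a b c d : I.

Definition pos_sign a b : R := order_sign R a b.
Definition val_sign a b : R := order_sign R (p a) (p b).

Lemma pos_sign_kernel : sign_kernel pos_sign.
Proof. exact: (order_sign_kernel R (f := @nat_of_ord n) val_inj). Qed.

Lemma val_sign_kernel : sign_kernel val_sign.
Proof.
apply: (order_sign_kernel R (f := fun i => nat_of_ord (p i))) => i j ij.
exact: (perm_inj (val_inj ij)).
Qed.

Local Notation kern := (rho_kernel pos_sign val_sign).

Lemma sym_kernel_val_sign a b c d : (a < b)%N -> (b < c)%N -> (c < d)%N ->
  let e := val_sign in
  sym2 (sym3 (sym4 kern)) a b c d =
  - 4 * (e a c * e a d) + 8 * (e a c * e b d) + 12 * (e b c * e b d)
  + 12 * (e a b * e a c) - 12 * (e a b * e a d) + 16 * (e a b * e c d)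
  - 4 * (e b c * e c d) + 12 * (e b d * e c d) - 4 * (e a b * e b c)
  + 4 * (e a b * e b d) + 4 * (e a c * e c d) - 12 * (e a d * e c d)
  + 12 * (e a c * e b c) - 4 * (e a d * e b d).
Proof.
move=> ab bc cd e.
have posE (i j : I) : (i < j)%N -> (pos_sign i j = 1) * (pos_sign j i = -1).
  by move=> ij; rewrite /pos_sign /order_sign ij ltnNge (ltnW ij) subr0 sub0r.
have ac := ltn_trans ab bc; have bd := ltn_trans bc cd; have ad := ltn_trans ac cd.
rewrite /sym2 /sym3 /sym4 /rho_kernel.
rewrite !(posE _ _ ab, posE _ _ bc, posE _ _ cd, posE _ _ ac, posE _ _ bd, posE _ _ ad).
have eC i j : val_sign j i = - e i j by exact: (sign_kernelC val_sign_kernel).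
rewrite (eC a b) (eC a c) (eC a d) (eC b c) (eC b d) (eC c d) -/e.
move: (e a b) (e a c) (e a d) (e b c) (e b d) (e c d) => eab eac ead ebc ebd ecd.
by ring.
Qed.

Definition monotone3 a b c : R :=
  ((p a < p b) && (p b < p c))%N%:R + ((p c < p b) && (p b < p a))%N%:R.

Definition value_chain4 a b c d : R :=
  ((p a < p b) && (p b < p c) && (p c < p d))%N%:R.

(** Checked on every order of the four values. A pattern of order 3 is averaged over the four
    triples, hence [16 = 64 / 4]. The arguments of [value_chain4] list the positions by increasing
    value, for 2143, 3412, 2413 and 3142 in turn. *)
Lemma sym_kernel_patterns a b c d : (a < b)%N -> (b < c)%N -> (c < d)%N ->
  sym2 (sym3 (sym4 kern)) a b c d =
  16 * (monotone3 a b c + monotone3 a b d + monotone3 a c d + monotone3 b c d)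
  + 64 * value_chain4 b a d c + 64 * value_chain4 c d a b
  + 32 * value_chain4 c a d b + 32 * value_chain4 b d a c - 24.
Proof.
move=> ab bc cd; rewrite sym_kernel_val_sign //.
have neq (i j : I) : (i < j)%N -> nat_of_ord (p i) != p j.
  by move=> ij; apply: contraTneq ij => /val_inj/perm_inj ->; rewrite ltnn.
have := neq _ _ ab; have := neq _ _ bc; have := neq _ _ cd.
have ac := ltn_trans ab bc; have bd := ltn_trans bc cd; have ad := ltn_trans ac cd.
have := neq _ _ ac; have := neq _ _ bd; have := neq _ _ ad.
rewrite /val_sign /order_sign /monotone3 /value_chain4.
move: (nat_of_ord (p a)) (nat_of_ord (p b)) (nat_of_ord (p c)) (nat_of_ord (p d)).
move=> {neq ab bc cd ac bd ad}a {}b {}c {}d.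
by case: (ltngtP a b) => // ab; case: (ltngtP b c) => // bc;
   case: (ltngtP c d) => // cd;
   case: (ltngtP a c) => // ac; try lia;
   case: (ltngtP b d) => // bd; try lia; case: (ltngtP a d) => // ad; try lia;
   move=> _ _ _ _ _ _; rewrite /=; lra.
Qed.

(** The bound 21 is the sum of the absolute values of the coefficients of the expanded kernel. *)
Lemma kernel_bound a b c d : `|kern a b c d| <= 21.
Proof.
have s1 (x y : nat) : `|order_sign R x y| <= 1.
  rewrite /order_sign; case: ltngtP => _ /=;
    by rewrite ?subrr ?subr0 ?sub0r ?normrN ?normr1 ?normr0.
have p1 (i j k l : I) : `|pos_sign i j * val_sign k l| <= 1.
  by rewrite normrM mulr_ile1 // s1.
have q1 (x y : R) : `|x| <= 1 -> `|y| <= 1 -> `|x * y| <= 1.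
  by move=> ? ?; rewrite normrM mulr_ile1.
pose t (i j k l i' j' k' l' : I) :=
  (pos_sign i j * val_sign k l) * (pos_sign i' j' * val_sign k' l').
have t1 i j k l i' j' k' l' : - 1 <= t i j k l i' j' k' l' <= 1.
  by rewrite -ler_norml q1.
have -> : kern a b c d = 2 * t c a c a d a d a + 2 * t c a c a d b d b
   + 4 * t c a c b d a d b + t c a c b d b d a - 4 * t c a c a d a d b
   - 4 * t c a c a d b d a - 4 * t c a c a d a b a.
  by rewrite /rho_kernel /t; ring.
have /andP[? ?] := t1 c a c a d a d a; have /andP[? ?] := t1 c a c a d b d b.
have /andP[? ?] := t1 c a c b d a d b; have /andP[? ?] := t1 c a c b d b d a.
have /andP[? ?] := t1 c a c a d a d b; have /andP[? ?] := t1 c a c a d b d a.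
have /andP[? ?] := t1 c a c a d a b a.
by rewrite ler_norml; apply/andP; split; lra.
Qed.

Definition sum3 (F : I -> I -> I -> R) : R := \sum_a \sum_b \sum_c F a b c.

Definition chain3 a b c : R := ((a < b) && (b < c))%N%:R.

(** An increasing triple extends to an increasing quadruple in [n - 3] ways; the four summands
    correspond to the rank of the added point. *)
Lemma sum4_chain4_triples (M : I -> I -> I -> R) :
  sum4 (fun a b c d => chain4 R a b c d * (M a b c + M a b d + M a c d + M b c d))
  = (n%:R - 3) * sum3 (fun a b c => chain3 a b c * M a b c).
Proof.
transitivity (sum4 (fun a b c d => chain4 R a b c d * M a b c)
  + sum4 (fun a b c d => chain4 R a b c d * M a b d)
  + sum4 (fun a b c d => chain4 R a b c d * M a c d)
  + sum4 (fun a b c d => chain4 R a b c d * M b c d)).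
  by rewrite -!sum4D; apply: eq_sum4 => a b c d; ring.
rewrite [X in _ + X + _ + _]sum4_cd.
rewrite [X in _ + _ + X + _]sum4_bc [X in _ + _ + X + _]sum4_cd.
rewrite [X in _ + _ + _ + X]sum4_ab [X in _ + _ + _ + X]sum4_bc.
rewrite [X in _ + _ + _ + X]sum4_cd.
rewrite -!sum4D /sum4 /sum3 mulr_sumr; apply: eq_bigr => a _.
rewrite mulr_sumr; apply: eq_bigr => b _; rewrite mulr_sumr; apply: eq_bigr => c _.
(* After the renamings [d] is the added point. Where [chain3] is nonzero, the last factor tells
   whether [d] is new. *)
transitivity (\sum_(d < n) chain3 a b c * M a b c
    * (1 - (a == d)%:R - (b == d)%:R - (c == d)%:R)).
  apply: eq_bigr => d _; rewrite -!mulrDl mulrAC; congr (_ * _).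
  rewrite -!(inj_eq val_inj) /= /chain4 /chain3.
  move: (val a) (val b) (val c) (val d) => {}a {}b {}c {}d.
  by case: (ltngtP a b) => ab; case: (ltngtP b c) => bc; rewrite /= ?andbF;
     case: (ltngtP c d) => cd; rewrite /= ?andbF; try lia;
     case: (ltngtP a d) => ad; try lia; case: (ltngtP b d) => bd; try lia;
     rewrite /=; ring.
rewrite -mulr_sumr !sumrB !sum_eq_ord sumr_const card_ord.
by ring.
Qed.

Lemma sum_kernel_patterns :
  `|sum4 kern
    - (16 * ((n%:R - 3) * sum3 (fun a b c => chain3 a b c * monotone3 a b c))
       + 64 * sum4 (fun a b c d => chain4 R a b c d * value_chain4 b a d c)
       + 64 * sum4 (fun a b c d => chain4 R a b c d * value_chain4 c d a b)
       + 32 * sum4 (fun a b c d => chain4 R a b c d * value_chain4 c a d b)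
       + 32 * sum4 (fun a b c d => chain4 R a b c d * value_chain4 b d a c)
       - 24 * sum4 (@chain4 R n))| <= 126 * n%:R ^+ 3.
Proof.
rewrite -sum4_chain4_triples.
have -> : 126 * n%:R ^+ 3 = 21 * (6 * n%:R ^+ 3) :> R by ring.
rewrite -mulNr -!sum4Z -!sum4D.
rewrite [X in _ - X](_ : _ = sum4 (mul4 (@chain4 R n) (sym2 (sym3 (sym4 kern))))).
  exact/sum4_chain/kernel_bound.
apply: eq_sum4 => a b c d; rewrite /mul4.
have [/andP[/andP[ab bc] cd]|/negbTE abcd] := boolP ((a < b) && (b < c) && (c < d))%N.
  by rewrite sym_kernel_patterns //; ring.
by rewrite /chain4 abcd !(mul0r, mulr0, addr0).
Qed.

End PatternKernel.

(** * Patterns given by words *)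

Lemma increasing_pattern_sorted k n (s : 'S_k) (y : {ffun 'I_k -> 'I_n}) l :
  map s l = enum 'I_k ->
  increasing (pattern_rel s) y = sorted ltn [seq val (y i) | i <- l].
Proof.
move=> sl; have -> : l = [seq (s^-1)%g i | i <- enum 'I_k].
  by rewrite -sl -map_comp map_id_in // => i _ /=; rewrite permK.
transitivity (increasing (@ord_rel k) [ffun i => y ((s^-1)%g i)]).
  apply/increasingP/increasingP => H i j ij.
    by rewrite !ffunE; apply: H; rewrite /pattern_rel !permKV.
  by have := H _ _ ij; rewrite !ffunE !permK.
rewrite increasing_sorted -!map_comp; congr (sorted _ _).
by apply: eq_map => i; rewrite /= ffunE.
Qed.

Lemma nth_word k (s : 'S_k) (i : 'I_k) : nth 0%N (word s) i = (val (s i)).+1.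
Proof. by rewrite (nth_map i) ?size_enum_ord // nth_ord_enum. Qed.

(** Permutations made by [of_word] are known only through their words. The list [l] is the inverse
    of [s] in one-line form, and the premise lets this be checked by computing on the word. *)
Lemma inverse_word k (s : 'S_k) l :
  [seq nth 0%N (word s) (val i) | i <- l] = iota 1 k -> map s l = enum 'I_k.
Proof.
move=> E; apply: (inj_map val_inj); rewrite val_enum_ord.
apply: (inj_map succn_inj); rewrite -[RHS](iotaDl 1 0) -E -!map_comp.
by apply: eq_map => i /=; rewrite nth_word.
Qed.

Lemma enum_ord3 : enum 'I_3 = [:: @Ordinal 3 0 isT; @Ordinal 3 1 isT; @Ordinal 3 2 isT].
Proof. by apply: (inj_map val_inj); rewrite val_enum_ord. Qed.

Lemma enum_ord4 : enum 'I_4 =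
  [:: @Ordinal 4 0 isT; @Ordinal 4 1 isT; @Ordinal 4 2 isT; @Ordinal 4 3 isT].
Proof. by apply: (inj_map val_inj); rewrite val_enum_ord. Qed.

Section SmallPatterns.
Variables (R : realType) (n : nat).

Lemma sum_ffun3 (F : 'I_n -> 'I_n -> 'I_n -> R) :
  \sum_(x : {ffun 'I_3 -> 'I_n})
     F (x (@Ordinal 3 0 isT)) (x (@Ordinal 3 1 isT)) (x (@Ordinal 3 2 isT))
  = sum3 F.
Proof.
rewrite /sum3; under [RHS]eq_bigr do rewrite pair_big.
rewrite pair_big /=.
pose h (u : 'I_n * ('I_n * 'I_n)) : {ffun 'I_3 -> 'I_n} :=
  [ffun i : 'I_3 => nth u.1 [:: u.1; u.2.1; u.2.2] i].
pose h' (x : {ffun 'I_3 -> 'I_n}) := (x (@Ordinal 3 0 isT),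
  (x (@Ordinal 3 1 isT), x (@Ordinal 3 2 isT))).
rewrite (reindex h) /=; first by apply: eq_bigr => u _; rewrite !ffunE.
exists h' => [[a [b c]] _|x _]; first by rewrite /h' !ffunE.
apply/ffunP => i; have : i \in enum 'I_3 by rewrite mem_enum.
by rewrite enum_ord3 !inE => /or3P[] /eqP ->; rewrite ffunE.
Qed.

Lemma sum_ffun4 (F : 'I_n -> 'I_n -> 'I_n -> 'I_n -> R) :
  \sum_(x : {ffun 'I_4 -> 'I_n})
     F (x (@Ordinal 4 0 isT)) (x (@Ordinal 4 1 isT))
       (x (@Ordinal 4 2 isT)) (x (@Ordinal 4 3 isT))
  = sum4 F.
Proof.
rewrite /sum4; under [RHS]eq_bigr do under eq_bigr do rewrite pair_big.
under [RHS]eq_bigr do rewrite pair_big; rewrite pair_big /=.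
pose h (u : 'I_n * ('I_n * ('I_n * 'I_n))) : {ffun 'I_4 -> 'I_n} :=
  [ffun i : 'I_4 => nth u.1 [:: u.1; u.2.1; u.2.2.1; u.2.2.2] i].
pose h' (x : {ffun 'I_4 -> 'I_n}) := (x (@Ordinal 4 0 isT),
  (x (@Ordinal 4 1 isT), (x (@Ordinal 4 2 isT), x (@Ordinal 4 3 isT)))).
rewrite (reindex h) /=; first by apply: eq_bigr => u _; rewrite !ffunE.
exists h' => [[a [b [c d]]] _|x _]; first by rewrite /h' !ffunE.
apply/ffunP => i; have : i \in enum 'I_4 by rewrite mem_enum.
by rewrite enum_ord4 !inE => /or4P[] /eqP ->; rewrite ffunE.
Qed.

Variable p : 'S_n.

Lemma card_copyE k (s : 'S_k) l : map s l = enum 'I_k ->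
  #|copy s p|%:R = \sum_(x : {ffun 'I_k -> 'I_n})
    (sorted ltn [seq val (x i) | i <- enum 'I_k]
     && sorted ltn [seq val (p (x i)) | i <- l])%:R :> R.
Proof.
move=> sl; rewrite card_copy -sum_bool_card; apply: eq_bigr => x _.
rewrite increasing_sorted -map_comp (increasing_pattern_sorted _ sl).
by congr (_ && sorted _ _)%:R; apply: eq_map => i; rewrite /= ffunE.
Qed.

Lemma sum4_chain4 : sum4 (@chain4 R n) = 'C(n, 4)%:R.
Proof.
rewrite -(card_increasing 4 n) -sum_bool_card -sum_ffun4; apply: eq_bigr => x _.
by rewrite increasing_sorted /= -map_comp enum_ord4 /= andbT andbA.
Qed.

Local Notation dens w := (density R (of_word w) (Tagged (fun k => 'S_k) p)).

Hypothesis n_ge4 : (4 <= n)%N.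

Lemma bin_neq0 k : (k <= 4)%N -> 'C(n, k)%:R != 0 :> R.
Proof. by move=> k4; rewrite pnatr_eq0 -lt0n bin_gt0 (leq_trans k4). Qed.

Lemma density_monotone3 :
  'C(n, 3)%:R * (dens [:: 1; 2; 3]%N + dens [:: 3; 2; 1]%N)
  = sum3 (fun a b c => chain3 R a b c * monotone3 R p a b c).
Proof.
have n3 : (3 <= n)%N := ltnW n_ge4.
rewrite /density /perm_order /= n3 -mulrDl mulrCA mulfV ?mulr1 ?bin_neq0 //.
have w1 := of_wordK (isT : perm_eq [:: 1; 2; 3]%N (iota 1 3)).
have w2 := of_wordK (isT : perm_eq [:: 3; 2; 1]%N (iota 1 3)).
have l1 := @inverse_word 3 (tagged (of_word [:: 1; 2; 3]%N))
  [:: @Ordinal 3 0 isT; @Ordinal 3 1 isT; @Ordinal 3 2 isT].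
have l2 := @inverse_word 3 (tagged (of_word [:: 3; 2; 1]%N))
  [:: @Ordinal 3 2 isT; @Ordinal 3 1 isT; @Ordinal 3 0 isT].
rewrite (card_copyE (l1 _)); last by rewrite w1.
rewrite (card_copyE (l2 _)); last by rewrite w2.
rewrite -big_split /= -sum_ffun3; apply: eq_bigr => x _.
rewrite enum_ord3 /= !andbT /chain3 /monotone3 -!mulnb !natrM.
by ring.
Qed.

Lemma density_pattern4 (s : 'S_4) (i j k l : 'I_4) :
  [seq nth 0%N (word s) (val i) | i <- [:: i; j; k; l]] = iota 1 4 ->
  'C(n, 4)%:R * density R (Tagged (fun k => 'S_k) s) (Tagged (fun k => 'S_k) p)
  = \sum_(x : {ffun 'I_4 -> 'I_n})
   chain4 R (x (@Ordinal 4 0 isT)) (x (@Ordinal 4 1 isT))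
       (x (@Ordinal 4 2 isT)) (x (@Ordinal 4 3 isT))
    * value_chain4 R p (x i) (x j) (x k) (x l).
Proof.
move=> lE; rewrite /density /perm_order /= n_ge4.
rewrite mulrCA mulfV ?mulr1 ?bin_neq0 //.
rewrite (@card_copyE _ s [:: i; j; k; l]); last exact: inverse_word.
apply: eq_bigr => x _; rewrite enum_ord4 /= !andbT !andbA.
by rewrite /chain4 /value_chain4 -!mulnb !natrM; ring.
Qed.

Lemma rho_star_kernel :
  `|sum4 (rho_kernel (@pos_sign R n) (val_sign R p))
    - 'C(n, 4)%:R * (64 * lincomb_density (rho_star R) (Tagged (fun k => 'S_k) p) - 24)|
  <= 126 * n%:R ^+ 3.
Proof.
(* This turns [16 * (n - 3) * 'C(n, 3)] into [64 * 'C(n, 4)], the normalization of the patterns of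
   order 4. *)
have C43 : 4 * 'C(n, 4)%:R = (n%:R - 3) * 'C(n, 3)%:R :> R.
  by rewrite -(natrB _ (ltnW n_ge4)) -!natrM mul_bin_left.
have E2143 : 'C(n, 4)%:R * dens [:: 2; 1; 4; 3]%N
    = sum4 (fun a b c d => chain4 R a b c d * value_chain4 R p b a d c).
  rewrite -sum_ffun4; apply: (@density_pattern4 (tagged (of_word [:: 2; 1; 4; 3]%N))
    (@Ordinal 4 1 isT) (@Ordinal 4 0 isT)
    (@Ordinal 4 3 isT) (@Ordinal 4 2 isT)).
  by rewrite (of_wordK (isT : perm_eq [:: 2; 1; 4; 3]%N (iota 1 4))).
have E3412 : 'C(n, 4)%:R * dens [:: 3; 4; 1; 2]%N
    = sum4 (fun a b c d => chain4 R a b c d * value_chain4 R p c d a b).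
  rewrite -sum_ffun4; apply: (@density_pattern4 (tagged (of_word [:: 3; 4; 1; 2]%N))
    (@Ordinal 4 2 isT) (@Ordinal 4 3 isT)
    (@Ordinal 4 0 isT) (@Ordinal 4 1 isT)).
  by rewrite (of_wordK (isT : perm_eq [:: 3; 4; 1; 2]%N (iota 1 4))).
have E2413 : 'C(n, 4)%:R * dens [:: 2; 4; 1; 3]%N
    = sum4 (fun a b c d => chain4 R a b c d * value_chain4 R p c a d b).
  rewrite -sum_ffun4; apply: (@density_pattern4 (tagged (of_word [:: 2; 4; 1; 3]%N))
    (@Ordinal 4 2 isT) (@Ordinal 4 0 isT)
    (@Ordinal 4 3 isT) (@Ordinal 4 1 isT)).
  by rewrite (of_wordK (isT : perm_eq [:: 2; 4; 1; 3]%N (iota 1 4))).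
have E3142 : 'C(n, 4)%:R * dens [:: 3; 1; 4; 2]%N
    = sum4 (fun a b c d => chain4 R a b c d * value_chain4 R p b d a c).
  rewrite -sum_ffun4; apply: (@density_pattern4 (tagged (of_word [:: 3; 1; 4; 2]%N))
    (@Ordinal 4 1 isT) (@Ordinal 4 3 isT)
    (@Ordinal 4 0 isT) (@Ordinal 4 2 isT)).
  by rewrite (of_wordK (isT : perm_eq [:: 3; 1; 4; 2]%N (iota 1 4))).
have := sum_kernel_patterns R p.
rewrite sum4_chain4 -density_monotone3 -E2143 -E3412 -E2413 -E3142.
suff -> : 'C(n, 4)%:R
      * (64 * lincomb_density (rho_star R) (Tagged (fun k => 'S_k) p) - 24)
   = 16 * ((n%:R - 3)
       * ('C(n, 3)%:R * (dens [:: 1; 2; 3]%N + dens [:: 3; 2; 1]%N)))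
    + 64 * ('C(n, 4)%:R * dens [:: 2; 1; 4; 3]%N)
    + 64 * ('C(n, 4)%:R * dens [:: 3; 4; 1; 2]%N)
    + 32 * ('C(n, 4)%:R * dens [:: 2; 4; 1; 3]%N)
    + 32 * ('C(n, 4)%:R * dens [:: 3; 1; 4; 2]%N)
    - 24 * 'C(n, 4)%:R by [].
rewrite [(n%:R - 3) * _]mulrA -C43 /lincomb_density /rho_star !big_cons big_nil /=.
move: (dens [:: 1; 2; 3]%N) (dens [:: 3; 2; 1]%N) (dens [:: 2; 1; 4; 3]%N)
  (dens [:: 3; 4; 1; 2]%N) (dens [:: 2; 4; 1; 3]%N) (dens [:: 3; 1; 4; 2]%N).
by move=> d1 d2 d3 d4 d5 d6; field.
Qed.

End SmallPatterns.

(** * Discrepancy *)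

Section Sawtooth.
Variables (R : realFieldType) (n : nat).

(** This is [n * s z u + m z - m u] for the order sign [s], whose column sums are
    [m z = 2 * z - (n - 1)]. *)
Definition sawtooth (z u : nat) : R := n%:R * order_sign R z u + 2 * z%:R - 2 * u%:R.

Lemma sum_ltn_ord u : (u <= n)%N -> \sum_(z < n) (z < u)%:R = u%:R :> R.
Proof. by move=> un; rewrite sum_bool_card card_ltn_ord. Qed.

Lemma sum_order_sign u : (u < n)%N ->
  \sum_(z < n) order_sign R z u = 2 * u%:R - (n%:R - 1).
Proof.
move=> un.
have E : \sum_(z < n) ((z < u)%:R + ((u < z)%:R + (Ordinal un == z)%:R)) = n%:R :> R.
  rewrite -[n in RHS]card_ord -sum1_card natr_sum; apply: eq_bigr => z _.
  by rewrite -(inj_eq val_inj) /=; case: ltngtP; rewrite /= ?addr0 ?add0r.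
rewrite !big_split /= sum_eq_ord sum_ltn_ord ?(ltnW un) // in E.
by rewrite /order_sign sumrB sum_ltn_ord ?(ltnW un) //; lra.
Qed.

Lemma sawtooth_bound z u : (z < n)%N -> (u < n)%N -> `|sawtooth z u| <= n%:R.
Proof.
move=> zn un; rewrite /sawtooth /order_sign ler_norml.
have zR : z%:R + 1 <= n%:R :> R by rewrite natr1 ler_nat.
have uR : u%:R + 1 <= n%:R :> R by rewrite natr1 ler_nat.
have z0 : 0 <= z%:R :> R by [].
have u0 : 0 <= u%:R :> R by [].
case: (ltngtP z u) => [zu|uz|->] /=; last by apply/andP; split; lra.
  have : z%:R + 1 <= u%:R :> R by rewrite natr1 ler_nat.
  by move=> ?; apply/andP; split; lra.
have : u%:R + 1 <= z%:R :> R by rewrite natr1 ler_nat.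
by move=> ?; apply/andP; split; lra.
Qed.

Lemma order_sign_homo z u u' : (u <= u')%N -> order_sign R z u <= order_sign R z u'.
Proof.
move=> uu'; rewrite /order_sign.
by case: (ltngtP z u) => zu; case: (ltngtP z u') => zu'; try lia; rewrite /=; lra.
Qed.

(** The linear parts contribute [2 * n * |u - u'|]. The sign differences all have the same
    direction, so their sum is a difference of column sums and contributes as much again. *)
Lemma sum_sawtooth_dist u u' : (u < n)%N -> (u' < n)%N ->
  \sum_(z < n) `|sawtooth z u - sawtooth z u'| <= 4 * n%:R * `|u%:R - u'%:R|.
Proof.
wlog uu' : u u' / (u <= u')%N => [H un u'n|un u'n].
  have [/H|/ltnW/H] := leqP u u'; first exact.
  rewrite distrC => /(_ u'n un); congr (_ <= _).
  by apply: eq_bigr => z _; rewrite distrC.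
have uuR : u%:R <= u'%:R :> R by rewrite ler_nat.
rewrite distrC ger0_norm ?subr_ge0 //.
apply: (@le_trans _ _ (\sum_(z < n) (n%:R * (order_sign R z u' - order_sign R z u)
    + 2 * (u'%:R - u%:R)))).
  apply: ler_sum => z _.
  have ss' : 0 <= order_sign R z u' - order_sign R z u.
    by rewrite subr_ge0 order_sign_homo.
  have -> : sawtooth z u - sawtooth z u' =
    - (n%:R * (order_sign R z u' - order_sign R z u)) + 2 * (u'%:R - u%:R).
    by rewrite /sawtooth; ring.
  have : 0 <= n%:R * (order_sign R z u' - order_sign R z u) by rewrite mulr_ge0.
  by rewrite ler_norml => ?; apply/andP; split; lra.
rewrite big_split /= -mulr_sumr sumrB !sum_order_sign // sumr_const card_ord.
rewrite -[_ *+ n]mulr_natl; lra.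
Qed.

Lemma order_sign_indicator z u :
  `|2 * (z < u)%:R - order_sign R z u + order_sign R z 0| <= (z == 0)%:R + (z == u)%:R.
Proof.
rewrite /order_sign ltn0 sub0r ler_norml.
case: (ltngtP z u) => zu; rewrite ?(eqn0Ngt z); case: (posnP z) => z0 /=; try lia;
  apply/andP; split; try lra.
Qed.

End Sawtooth.

(** * Sawtooth correlations and box counts *)

Section Discrepancy.
Variables (R : realFieldType) (n : nat) (p : 'S_n).
Local Notation st := (sawtooth R n).
Local Notation N := (n%:R : R).

(** This is the centered concordance with its second argument indexed by value instead of position,
    which makes it Lipschitz in both arguments. *)
Definition sawtooth_corr (u v : nat) : R := \sum_(z < n) st z u * st (p z) v.
Local Notation cc := sawtooth_corr.

Lemma sum_permuted (F : nat -> R) : \sum_(z < n) F (p z) = \sum_(z < n) F z.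
Proof. by rewrite [RHS](reindex_inj (@perm_inj _ p)). Qed.

Lemma centered_concordanceE (B C : 'I_n) :
  centered_concordance (@pos_sign R n) (val_sign R p) B C = cc B (p C).
Proof.
have mE D : colsum (@pos_sign R n) D = 2 * D%:R - (N - 1).
  exact: sum_order_sign.
have m'E D : colsum (val_sign R p) D = 2 * (p D)%:R - (N - 1).
  by rewrite /colsum /val_sign (sum_permuted (order_sign R ^~ (p D))) sum_order_sign.
apply: eq_bigr => z _; rewrite !mE !m'E card_ord /sawtooth /pos_sign /val_sign.
by congr (_ * _); ring.
Qed.

Lemma sum_centered_concordance :
  \sum_B \sum_C centered_concordance (@pos_sign R n) (val_sign R p) B C ^+ 2
  = \sum_(u < n) \sum_(v < n) cc u v ^+ 2.
Proof.
apply: eq_bigr => u _; under eq_bigr do rewrite centered_concordanceE.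
by rewrite (sum_permuted (fun v => cc u v ^+ 2)).
Qed.

Lemma sawtooth_corr_lipschitz u u' v v' :
  (u < n)%N -> (u' < n)%N -> (v < n)%N -> (v' < n)%N ->
  `|cc u v - cc u' v'| <= 4 * N ^+ 2 * (`|u%:R - u'%:R| + `|v%:R - v'%:R|).
Proof.
move=> un u'n vn v'n.
have -> : cc u v - cc u' v' = \sum_(z < n) (st z u - st z u') * st (p z) v
    + \sum_(z < n) st z u' * (st (p z) v - st (p z) v').
  by rewrite /cc -sumrB -big_split; apply: eq_bigr => z _ /=; ring.
have -> : 4 * N ^+ 2 * (`|u%:R - u'%:R| + `|v%:R - v'%:R|)
  = (4 * N * `|u%:R - u'%:R|) * N + N * (4 * N * `|v%:R - v'%:R|) by ring.
apply: le_trans (ler_normD _ _) (lerD _ _).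
  apply: (@le_trans _ _ ((\sum_(z < n) `|st z u - st z u'|) * N)).
    rewrite mulr_suml; apply: le_trans (ler_norm_sum _ _ _) _.
    apply: ler_sum => z _; rewrite normrM ler_wpM2l //.
    exact: sawtooth_bound.
  by rewrite ler_wpM2r ?ler0n // sum_sawtooth_dist.
apply: (@le_trans _ _ (N * \sum_(z < n) `|st (p z) v - st (p z) v'|)).
  rewrite mulr_sumr; apply: le_trans (ler_norm_sum _ _ _) _.
  by apply: ler_sum => z _; rewrite normrM ler_wpM2r // sawtooth_bound.
rewrite (sum_permuted (fun z => `|st z v - st z v'|)).
by rewrite ler_wpM2l ?ler0n // sum_sawtooth_dist.
Qed.

(** A value above [M] in absolute value persists up to a factor 2 on a window of [w] by [w] points,
    by the Lipschitz bound [8 * N ^ 2 * w <= M / 2]. The squares there already sum to more than the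
    assumed total. *)
Lemma sawtooth_corr_sup (w : nat) (M : R) :
  (0 < w <= n)%N -> 16 * N ^+ 2 * w%:R <= M ->
  4 * (\sum_(u < n) \sum_(v < n) cc u v ^+ 2) <= w%:R ^+ 2 * M ^+ 2 ->
  forall u v, (u < n)%N -> (v < n)%N -> `|cc u v| <= M.
Proof.
move=> /andP[w0 wn] wM SM u0 v0 u0n v0n; rewrite leNgt; apply/negP => ltM.
have M0 : 0 <= M by apply: le_trans wM; rewrite !mulr_ge0 // exprn_ge0.
(* The window starts at [x0], shifted down if necessary to fit below [n]. *)
pose win (x0 x : nat) := (minn x0 (n - w) <= x < minn x0 (n - w) + w)%N.
have win_close x0 x : (x0 < n)%N -> win x0 x -> `|x%:R - x0%:R| <= w%:R :> R.
  move=> x0n; rewrite /win => /andP[h1 h2].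
  have l1 : (x <= x0 + w)%N by lia.
  have l2 : (x0 <= x + w)%N by lia.
  move: l1 l2; rewrite -!(ler_nat R) !natrD ler_norml => ? ?.
  by apply/andP; split; lra.
have sum_win x0 : \sum_(x < n) (win x0 x)%:R = w%:R :> R.
  under eq_bigr do rewrite ltn_max_sub (maxn_idPr (leq_addr _ _)).
  rewrite sumrB !sum_ltn_ord; [by rewrite natrD; ring | by lia | by lia].
set c0 := cc u0 v0 in ltM *.
have big u v : (u < n)%N -> (v < n)%N -> win u0 u -> win v0 v ->
    c0 ^+ 2 / 4 <= cc u v ^+ 2.
  move=> un vn /(win_close _ _ u0n) uw /(win_close _ _ v0n) vw.
  have := sawtooth_corr_lipschitz un u0n vn v0n; rewrite -/c0 => lip.
  have : `|cc u v - c0| <= `|c0| / 2.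
    apply: le_trans lip _.
    have : 4 * N ^+ 2 * (`|u%:R - u0%:R| + `|v%:R - v0%:R|) <= 4 * N ^+ 2 * (2 * w%:R).
      by rewrite ler_wpM2l ?mulr_ge0 ?exprn_ge0 //; lra.
    by move=> h; apply: le_trans h _; lra.
  move=> h; have h2 : `|c0| / 2 <= `|cc u v|.
    have := ler_normD (cc u v) (c0 - cc u v).
    by rewrite addrC subrK distrC; lra.
  rewrite -(real_normK (num_real c0)) -(real_normK (num_real (cc u v))).
  by have := normr_ge0 c0; nra.
have S_ge : w%:R ^+ 2 * (c0 ^+ 2 / 4) <= \sum_(u < n) \sum_(v < n) cc u v ^+ 2.
  have -> : w%:R ^+ 2 * (c0 ^+ 2 / 4) =
     \sum_(u < n) \sum_(v < n) (win u0 u)%:R * ((win v0 v)%:R * (c0 ^+ 2 / 4)).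
    under eq_bigr do rewrite -mulr_sumr -mulr_suml sum_win.
    by rewrite -mulr_suml sum_win; ring.
  apply: ler_sum => u _; apply: ler_sum => v _.
  case: (boolP (win u0 u)) => wu; last by rewrite mul0r sqr_ge0.
  case: (boolP (win v0 v)) => wv; last by rewrite mul0r mulr0 sqr_ge0.
  by rewrite !mul1r; exact: big.
have w0R : 0 < w%:R ^+ 2 :> R by rewrite exprn_gt0 // ltr0n.
have : w%:R ^+ 2 * c0 ^+ 2 <= w%:R ^+ 2 * M ^+ 2 by lra.
rewrite ler_pM2l // -(real_normK (num_real c0)).
by rewrite ler_pXn2r ?nnegrE // leNgt ltM.
Qed.

(** The centered indicators [h] and the sawtooth differences [g] differ only at the endpoints, by at
    most [2 * N] in total. Both are bounded by [2 * N], so exchanging the two factors in turn costs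
    [4 * N ^ 2] each. *)
Lemma quadrant_sawtooth (u v : nat) : (u < n)%N -> (v < n)%N ->
  `|4 * (N ^+ 2 * (quadrant p u v)%:R - N * u%:R * v%:R)
    - (cc u v - cc 0 v - cc u 0 + cc 0 0)| <= 8 * N ^+ 2.
Proof.
move=> un vn; have n0 : (0 < n)%N by case: (n) un.
pose h (z x : nat) : R := 2 * (N * (z < x)%:R - x%:R).
pose g (z x : nat) : R := st z x - st z 0.
have sum_h x : (x <= n)%N -> \sum_(z < n) (z < x)%:R = x%:R :> R by exact: sum_ltn_ord.
have quadE : 4 * (N ^+ 2 * (quadrant p u v)%:R - N * u%:R * v%:R)
    = \sum_(z < n) h z u * h (p z) v.
  rewrite /quadrant -sum_bool_card.
  transitivity (\sum_(z < n) (4 * N ^+ 2 * ((z < u) && (p z < v))%N%:R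
     - 4 * N * v%:R * (z < u)%:R - 4 * N * u%:R * (p z < v)%:R + 4 * u%:R * v%:R)).
    rewrite !(sumrB, big_split) /= -!mulr_sumr.
    rewrite (sum_permuted (fun z => (z < v)%:R)) !sum_h ?(ltnW un) ?(ltnW vn) //.
    by rewrite sumr_const card_ord -[_ *+ n]mulr_natl; ring.
  by apply: eq_bigr => z _; rewrite -mulnb natrM /h; ring.
have ccE : cc u v - cc 0 v - cc u 0 + cc 0 0 = \sum_(z < n) g z u * g (p z) v.
  rewrite /cc -!(sumrB, big_split) /=; apply: eq_bigr => z _.
  by rewrite /g; ring.
have hb z x : (x <= n)%N -> `|h z x| <= 2 * N.
  move=> xn; have : x%:R <= N by rewrite ler_nat.
  have : 0 <= x%:R :> R by [].
  rewrite /h ler_norml; case: (z < x)%N;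
    rewrite /= ?mulr1 ?mulr0 => ? ?; apply/andP; split; lra.
have gb (z : 'I_n) x : (x < n)%N -> `|g z x| <= 2 * N.
  move=> xn; rewrite /g; apply: le_trans (ler_normB _ _) _.
  have := sawtooth_bound R (ltn_ord z) xn; have := sawtooth_bound R (ltn_ord z) n0.
  lra.
have hg x : (x < n)%N -> \sum_(z < n) `|h z x - g z x| <= 2 * N.
  move=> xn.
  apply: (@le_trans _ _ (\sum_(z < n) N * ((Ordinal n0 == z)%:R + (Ordinal xn == z)%:R))).
    apply: ler_sum => z _.
    have -> : h z x - g z x
       = N * (2 * (z < x)%:R - order_sign R z x + order_sign R z 0).
      by rewrite /h /g /sawtooth; ring.
    rewrite normrM ger0_norm ?ler0n // ler_wpM2l ?ler0n //.
    rewrite -!(inj_eq val_inj) /= [(0 == z)%N]eq_sym [(x == z)%N]eq_sym.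
    exact: order_sign_indicator.
  by rewrite -mulr_sumr big_split /= !sum_eq_ord; lra.
rewrite quadE ccE.
have -> : \sum_(z < n) h z u * h (p z) v - \sum_(z < n) g z u * g (p z) v
  = \sum_(z < n) (h z u - g z u) * h (p z) v
    + \sum_(z < n) g z u * (h (p z) v - g (p z) v).
  by rewrite -sumrB -big_split; apply: eq_bigr => z _ /=; ring.
have -> : 8 * N ^+ 2 = (2 * N) * (2 * N) + (2 * N) * (2 * N) by ring.
apply: le_trans (ler_normD _ _) (lerD _ _).
  apply: (@le_trans _ _ ((\sum_(z < n) `|h z u - g z u|) * (2 * N))).
    rewrite mulr_suml; apply: le_trans (ler_norm_sum _ _ _) _.
    by apply: ler_sum => z _; rewrite normrM ler_wpM2l // hb // ltnW.
  by rewrite ler_wpM2r ?mulr_ge0 // hg.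
apply: (@le_trans _ _ ((2 * N) * \sum_(z < n) `|h (p z) v - g (p z) v|)).
  rewrite mulr_sumr; apply: le_trans (ler_norm_sum _ _ _) _.
  by apply: ler_sum => z _; rewrite normrM ler_wpM2r // gb.
rewrite (sum_permuted (fun z => `|h z v - g z v|)).
by rewrite ler_wpM2l ?mulr_ge0 // hg.
Qed.

Lemma quadrant_discrepancy (M : R) : (0 < n)%N ->
  (forall u v, (u < n)%N -> (v < n)%N -> `|cc u v| <= M) ->
  forall u v, (u <= n)%N -> (v <= n)%N ->
  `|(quadrant p u v)%:R - u%:R * v%:R / N| <= M / N ^+ 2 + 2.
Proof.
move=> n0 ccM u v un vn.
have N0 : 0 < N by rewrite ltr0n.
have M0 : 0 <= M by apply: le_trans (ccM 0%N 0%N n0 n0).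
have rhs0 : 0 <= M / N ^+ 2 + 2 by rewrite addr_ge0 // divr_ge0 // exprn_ge0.
(* [quadrant_sawtooth] needs [u] and [v] below [n]; when one of them equals [n] the count is
   exact. *)
have [un'|nu] := ltnP u n; last first.
  have -> : u = n by apply/eqP; rewrite eqn_leq un.
  rewrite /quadrant -sum_bool_card.
  under eq_bigr do rewrite ltn_ord /=.
  rewrite (sum_permuted (fun z => (z < v)%:R)) sum_ltn_ord //.
  by rewrite mulrAC mulfV ?gt_eqF // mul1r subrr normr0.
have [vn'|nv] := ltnP v n; last first.
  have -> : v = n by apply/eqP; rewrite eqn_leq vn.
  rewrite /quadrant -sum_bool_card.
  under eq_bigr do rewrite ltn_ord andbT.
  by rewrite sum_ltn_ord // mulfK ?gt_eqF // subrr normr0.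
have := quadrant_sawtooth un' vn'.
have := ccM _ _ un' vn'; have := ccM _ _ n0 vn'.
have := ccM _ _ un' n0; have := ccM _ _ n0 n0.
rewrite !ler_norml => /andP[? ?] /andP[? ?] /andP[? ?] /andP[? ?] /andP[? ?].
have -> : (quadrant p u v)%:R - u%:R * v%:R / N
   = (N ^+ 2 * (quadrant p u v)%:R - N * u%:R * v%:R) / N ^+ 2.
  by field; rewrite gt_eqF.
have -> : M / N ^+ 2 + 2 = (M + 2 * N ^+ 2) / N ^+ 2 by field; rewrite gt_eqF.
rewrite -mulNr !ler_pM2r ?invr_gt0 ?exprn_gt0 //.
by apply/andP; split; lra.
Qed.

End Discrepancy.

Lemma ffact_leq_exp n k : (n ^_ k <= n ^ k)%N.
Proof.
by elim: k => // k IH; rewrite ffactnSr expnSr leq_mul // leq_subr.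
Qed.

(** * From the density of [rho_star] to all pattern densities *)

Section Forcing.
Variable R : realType.

Lemma sawtooth_corr_energy n (q : 'S_n) : (4 <= n)%N ->
  \sum_(u < n) \sum_(v < n) sawtooth_corr R q u v ^+ 2
  <= n%:R ^+ 8 * (43 / n%:R
       + `|lincomb_density (rho_star R) (Tagged (fun k => 'S_k) q) - 11 / 24|).
Proof.
move=> n4; have := sum_rho_kernel_ge (@pos_sign_kernel R n) (val_sign_kernel R q).
rewrite sum_centered_concordance card_ord.
have := rho_star_kernel R q n4; rewrite /sum4.
set S := \sum_(u < n) _; set K := \sum_a _.
set rho := lincomb_density _ _; set N := n%:R.
rewrite ler_norml => /andP[_ Kle] Sle.
have N4 : 4 <= N by rewrite ler_nat.
have N0 : 0 < N by lra.
have C4 : 24 * 'C(n, 4)%:R <= N ^+ 4 :> R.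
  by rewrite -natrM -natrX ler_nat mulnC (bin_ffact n 4) ffact_leq_exp.
have C0 : 0 <= 'C(n, 4)%:R :> R by [].
(* At density [11 / 24] the factor is [64 * 11 / 24 - 24 = 16 / 3], and ['C(n, 4) <= N ^ 4 / 24]
   yields the same [2 / 9] as the lower bound. *)
have rho_le : 'C(n, 4)%:R * (64 * rho - 24)
    <= N ^+ 4 * (2 / 9 + 8 / 3 * `|rho - 11 / 24|).
  have := ler_norm (rho - 11 / 24); have := normr_ge0 (rho - 11 / 24).
  set t := `|_| => t0 tle.
  apply: (@le_trans _ _ ('C(n, 4)%:R * (16 / 3 + 64 * t))).
    by rewrite ler_wpM2l //; lra.
  have -> : 'C(n, 4)%:R * (16 / 3 + 64 * t)
     = 24 * 'C(n, 4)%:R * (2 / 9 + 8 / 3 * t) by field.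
  by rewrite ler_wpM2r //; lra.
have N40 : 0 <= N ^+ 4 by rewrite exprn_ge0 // ltW.
have : N ^+ 4 * K <= N ^+ 4 * (N ^+ 4 * (2 / 9 + 8 / 3 * `|rho - 11 / 24|) + 126 * N ^+ 3).
  by rewrite ler_wpM2l //; lra.
move=> K4; have t0 := normr_ge0 (rho - 11 / 24).
set t := `|_| in t0 K4 *.
have -> : N ^+ 8 * (43 / N + t) = N ^+ 4 * (43 * N ^+ 3 + N ^+ 4 * t).
  by field; rewrite gt_eqF.
(* The terms [2 / 9 * N ^ 4] cancel, and [3 * 43 = 126 + 3] leaves [3 * N ^ 3] to absorb the
   quadratic terms. *)
have : N ^+ 4 * (N ^+ 4 * (2 / 9 + 8 / 3 * t) + 126 * N ^+ 3
   - (2 / 9 * (N ^+ 2 - 1) ^+ 2 - 4 / 3 * (N ^+ 2 - 1)))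
   <= N ^+ 4 * (3 * (43 * N ^+ 3 + N ^+ 4 * t)).
  rewrite ler_wpM2l //.
  have : 0 <= N ^+ 4 * t by rewrite mulr_ge0.
  have : 4 * N ^+ 2 <= N ^+ 3 by rewrite exprSr ler_pM2r // ?exprn_gt0 //; nra.
  have : 0 <= N ^+ 2 by rewrite sqr_ge0.
  have -> : (N ^+ 2 - 1) ^+ 2 = N ^+ 4 - 2 * N ^+ 2 + 1 by ring.
  have -> : N ^+ 4 * (2 / 9 + 8 / 3 * t) = 2 / 9 * N ^+ 4 + 8 / 3 * (N ^+ 4 * t) by ring.
  lra.
lra.
Qed.

(** Here [e] is the relative width of the window in [sawtooth_corr_sup], used with
    [M = 16 * e * n ^ 3]; its energy condition becomes the bound [16 * e ^ 4]. *)
Lemma density_estimate (s q : permutation) (e : R) :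
  let n := perm_order q in let k := perm_order s in
  (4 <= n)%N -> (k <= n)%N -> 0 < e <= 1 -> 2 <= e * n%:R ->
  43 / n%:R + `|lincomb_density (rho_star R) q - 11 / 24| <= 16 * e ^+ 4 ->
  `|density R s q - 'C(n, k)%:R / n%:R ^+ k|
    <= 68 * k%:R * e * (n%:R ^+ k / 'C(n, k)%:R).
Proof.
case: q => n q; case: s => k s; rewrite /perm_order /= => n4 kn /andP[e0 e1] en rho_le.
have n0 : (0 < n)%N by apply: leq_trans n4.
have N0 : 0 < n%:R :> R by rewrite ltr0n.
(* Since [2 <= e * n], rounding down loses at most half of [e * n]. *)
pose w := Num.truncn (e * n%:R).
have en0 : 0 <= e * n%:R by rewrite mulr_ge0 // ltW.
have /andP[w_le w_gt] : w%:R <= e * n%:R < w.+1%:R by exact: truncn_itv.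
have w0 : (0 < w <= n)%N.
  rewrite -(ltr_nat R) -(ler_nat R); apply/andP; split.
    by move: w_gt; rewrite -natr1; lra.
  by apply: le_trans w_le _; rewrite ler_piMl // ltW.
have w_half : e * n%:R <= 2 * w%:R by move: w_gt; rewrite -natr1; lra.
have energy := sawtooth_corr_energy q n4.
have sup := @sawtooth_corr_sup R n q w (16 * e * n%:R ^+ 3) w0.
have {}sup : forall u v, (u < n)%N -> (v < n)%N ->
    `|sawtooth_corr R q u v| <= 16 * e * n%:R ^+ 3.
  apply: sup.
    have -> : 16 * e * n%:R ^+ 3 = 16 * n%:R ^+ 2 * (e * n%:R) by ring.
    by rewrite ler_wpM2l // mulr_ge0 // exprn_ge0.
  apply: (@le_trans _ _ (4 * (n%:R ^+ 8 * (16 * e ^+ 4)))).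
    rewrite ler_wpM2l //; apply: le_trans energy _.
    by rewrite ler_wpM2l // exprn_ge0.
  have -> : 4 * (n%:R ^+ 8 * (16 * e ^+ 4))
     = (e * n%:R / 2) ^+ 2 * (16 * e * n%:R ^+ 3) ^+ 2 by field.
  rewrite ler_wpM2r ?sqr_ge0 // ler_pXn2r ?nnegrE //; lra.
have disc := quadrant_discrepancy n0 sup.
have := counting_lemma s n0 disc.
have Cn0 : 0 < 'C(n, k)%:R :> R by rewrite ltr0n bin_gt0.
rewrite /density /= kn => count.
have -> : #|copy s q|%:R / 'C(n, k)%:R - 'C(n, k)%:R / n%:R ^+ k
   = (#|copy s q|%:R - 'C(n, k)%:R ^+ 2 / n%:R ^+ k) / 'C(n, k)%:R :> R.
  by field; rewrite !gt_eqF // exprn_gt0.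
rewrite normrM normfV (gtr0_norm Cn0) mulrA ler_pM2r ?invr_gt0 //.
apply: le_trans count _.
(* For [k = 0] the predecessor in the exponent is truncated, but both sides vanish. *)
case: k {s kn Cn0} => [|k]; first by rewrite !(mul0r, mulr0).
(* [68 = 4 * 17]: the discrepancy [16 * e * n + 2] is at most [17 * e * n]. *)
have -> : 68 * k.+1%:R * e * n%:R ^+ k.+1
   = k.+1%:R * (4 * (17 * (e * n%:R)) * n%:R ^+ k) :> R by rewrite exprS; ring.
rewrite ler_wpM2l //= ler_wpM2r ?exprn_ge0 // ler_wpM2l //.
have -> : 16 * e * n%:R ^+ 3 / n%:R ^+ 2 = 16 * (e * n%:R) :> R.
  by field; rewrite gt_eqF.
lra.
Qed.

End Forcing.

(** * Limits *)

Local Open Scope classical_set_scope.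
Local Open Scope ring_scope.

Lemma cvg_ffact_exp (R : realType) k :
  (fun n => (n ^_ k)%:R / n%:R ^+ k : R) @ \oo --> (1 : R).
Proof.
elim: k => [|k IH].
  apply: cvg_near_cst; apply: nearW => n.
  by rewrite ffactn0 expr0 divr1.
have inv0 : (fun n => k%:R / n%:R : R) @ \oo --> (0 : R).
  apply/cvgrPdist_le => e e0; near=> n.
  have ne : k%:R / e <= n%:R by near: n; exact: nbhs_infty_ger.
  have n0 : (0 < n)%N by near: n; exact: nbhs_infty_ge.
  have N0 : 0 < n%:R :> R by rewrite ltr0n.
  rewrite sub0r normrN ger0_norm ?divr_ge0 // ler_pdivrMr //.
  by rewrite mulrC -ler_pdivrMr.
have step : (fun n => (n ^_ k)%:R / n%:R ^+ k * (1 - k%:R / n%:R) : R) @ \oo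
    --> (1 * (1 - 0) : R).
  by apply: cvgM => //; apply: cvgB => //; exact: cvg_cst.
rewrite subr0 mulr1 in step.
apply: (cvg_trans _ step); apply: near_eq_cvg; near=> n.
have n0 : (0 < n)%N by near: n; exact: nbhs_infty_ge.
have kn : (k <= n)%N by near: n; exact: nbhs_infty_ge.
have N0 : n%:R != 0 :> R by rewrite pnatr_eq0 -lt0n.
rewrite /= ffactnSr natrM natrB // exprSr; field.
by rewrite N0 expf_neq0.
Unshelve. all: by end_near.
Qed.

Lemma cvg_bin_exp (R : realType) k :
  (fun n => 'C(n, k)%:R / n%:R ^+ k : R) @ \oo --> (k`!%:R^-1 : R).
Proof.
have step : (fun n => (n ^_ k)%:R / n%:R ^+ k * k`!%:R^-1 : R) @ \oo
    --> (1 * k`!%:R^-1 : R).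
  by apply: cvgM; [exact: cvg_ffact_exp | exact: cvg_cst].
rewrite mul1r in step; apply: (cvg_trans _ step).
apply: near_eq_cvg; apply: nearW => n.
rewrite /= -(bin_ffact n k) natrM mulrAC mulfK //.
Qed.

Lemma rho_star_limit (R : realType) :
  \sum_(t <- rho_star R) t.1 / (perm_order t.2)`!%:R = 11 / 24.
Proof.
rewrite /rho_star !big_cons big_nil /perm_order /=.
rewrite !factS fact0; lra.
Qed.

Theorem theorem1p1 (R : realType) : quasirandom_forcing (rho_star R).
Proof.
move=> p p_infty; rewrite rho_star_limit => p_rho s.
set k := perm_order s.
have bin_lim : (fun n => 'C(perm_order (p n), k)%:R
    / (perm_order (p n))%:R ^+ k : R) @ \oo --> (k`!%:R^-1 : R).
  exact: (cvg_comp _ _ p_infty (@cvg_bin_exp R k)).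
suff diff0 : (fun n => density R s (p n)
    - 'C(perm_order (p n), k)%:R / (perm_order (p n))%:R ^+ k) @ \oo --> (0 : R).
  rewrite -[_^-1]add0r; apply: (cvg_trans _ (cvgD diff0 bin_lim)).
  by apply: near_eq_cvg; apply: nearW => n; rewrite /= subrK.
apply/cvgrPdist_le => e e0.
have K0 : 0 < k`!%:R :> R by rewrite ltr0n fact_gt0.
(* The factor [2 * k!] will bound [N ^ k / 'C(N, k)]; the successor of [k] keeps [c] positive for
   [k = 0]. *)
pose c : R := 68 * k.+1%:R * (2 * k`!%:R).
have c0 : 0 < c by rewrite !mulr_gt0.
pose d := Num.min 1 (e / c).
have d0 : 0 < d by rewrite lt_min ltr01 divr_gt0.
have d1 : d <= 1 by rewrite ge_min lexx.
have de : c * d <= e by rewrite mulrC -ler_pdivlMr // ge_min lexx orbT.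
have d4 : 0 < 16 * d ^+ 4 by rewrite mulr_gt0 // exprn_gt0.
near=> n; rewrite sub0r normrN.
have N4 : (4 <= perm_order (p n))%N.
  by near: n; exact: p_infty (nbhs_infty_ge 4).
have Nk : (k <= perm_order (p n))%N.
  by near: n; exact: p_infty (nbhs_infty_ge k).
have Nd : 2 / d <= (perm_order (p n))%:R.
  by near: n; exact: p_infty (nbhs_infty_ger (2 / d)).
(* The budget [16 * d ^ 4] of [density_estimate] is split evenly between [43 / N] and the deviation
   of the density from [11 / 24]. *)
have NE : 43 / (8 * d ^+ 4) <= (perm_order (p n))%:R.
  by near: n; exact: p_infty (nbhs_infty_ger (43 / (8 * d ^+ 4))).
have rho_close : `|11 / 24 - lincomb_density (rho_star R) (p n)| <= 8 * d ^+ 4.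
  by near: n; apply: cvgr_dist_le p_rho _ _; rewrite mulr_gt0 // exprn_gt0.
have bin_close : `|k`!%:R^-1 - 'C(perm_order (p n), k)%:R
     / (perm_order (p n))%:R ^+ k| <= k`!%:R^-1 / 2 :> R.
  by near: n; apply: cvgr_dist_le bin_lim _ _; rewrite divr_gt0 // invr_gt0.
set N := perm_order (p n) in N4 Nk Nd NE bin_close *.
have N0 : 0 < N%:R :> R by rewrite ltr0n (leq_trans _ N4).
apply: (@le_trans _ _ (68 * k%:R * d * (N%:R ^+ k / 'C(N, k)%:R))).
  apply: density_estimate => //; first by rewrite d0.
    by rewrite mulrC -ler_pdivrMr.
  have : 43 / N%:R <= 8 * d ^+ 4.
    rewrite ler_pdivrMr // mulrC -ler_pdivrMr // mulr_gt0 // exprn_gt0 //.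
  by move: rho_close; rewrite distrC; lra.
have C0 : 0 < 'C(N, k)%:R :> R by rewrite ltr0n bin_gt0.
have Nk0 : 0 < N%:R ^+ k :> R by rewrite exprn_gt0.
have inv_le : N%:R ^+ k / 'C(N, k)%:R <= 2 * k`!%:R :> R.
  have C_ge : k`!%:R^-1 / 2 * N%:R ^+ k <= 'C(N, k)%:R :> R.
    rewrite -ler_pdivlMr //; move: bin_close; rewrite ler_norml => /andP[_].
    lra.
  rewrite ler_pdivrMr //.
  have -> : N%:R ^+ k = 2 * k`!%:R * (k`!%:R^-1 / 2 * N%:R ^+ k) :> R.
    by field; rewrite gt_eqF.
  by rewrite ler_wpM2l // mulr_ge0.
apply: le_trans de; rewrite /c.
have -> : 68 * k.+1%:R * (2 * k`!%:R) * d = 68 * k.+1%:R * d * (2 * k`!%:R) by ring.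
apply: ler_pM; [| by rewrite divr_ge0 // ltW | | exact: inv_le].
  by rewrite !mulr_ge0 // ltW.
by rewrite ler_wpM2r ?(ltW d0) // ler_wpM2l // ler_nat.
Unshelve. all: by end_near.
Qed.
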